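(* Let $M$ and $N$ be tame persistence modules indexed by $\mathbb{R}$ with persistence diagrams $D,E:\mathbb{R}^2_<\to\mathbb{Z}_{\ge0}$ and $k$-th graded persistence diagrams $D_k,E_k:\mathbb{R}^2_<\to\mathbb{Z}$ for $k\ge1$. Let $K$ be the maximum of the values attained by the rank functions of $M$ and $N$. Then (i) for $1\le k<K$, $W_{1,1}(D_k,E_k)\le 2\,W_{1,1}(D,E)$; (ii) if $K\ge1$, $W_{1,1}(D_K,E_K)\le W_{1,1}(D,E)$; (iii) for $k>K$, $D_k=E_k=0$. Furthermore, there exist $M$ and $N$ such that all of these bounds are attained.
   Context: Tame persistence modules. Let $F$ be a field and $[m]=\{0<1<\dots<m\}$. A persistence module indexed by a sub-poset $P$ of $(\mathbb{R},\le)$ is a functor from $P$ to finite-dimensional $F$-vector spaces. Given $M'$ indexed by $[m]$, extend it to $\hat M'$ indexed by $[m+1]$ by $\hat M'(m+1)=0$. Given an injective order-preserving $\iota:[m+1]\to\mathbb{R}$, $\overline{M'}$ is the persistence module indexed by $\mathbb{R}$ with $\overline{M'}(a)=\hat M'(i)$, where $i$ is the largest element of $[m+1]$ with $\iota(i)\le a$, and $\overline{M'}(a)=0$ if $a<\iota(0)$, with induced structure maps. A persistence module indexed by $\mathbb{R}$ is tame if it is isomorphic to some $\overline{M'}$ (for some $m$, $M'$, $\iota$). The rank function of a persistence module $M$ is $[a,b]\mapsto\operatorname{rank}M(a\le b)$, $a\le b$. Diagrams. For a poset $P$, $P^2_<$ is the poset of half-open intervals $[a,b)$, $a<b$ in $P$,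 ordered by inclusion. For $[a,b)\in[m+1]^2_<$ let $\operatorname{Rank}(M')[a,b)=\operatorname{rank}M'(a\le b-1)$, and let $\operatorname{Rank}_k(M')[a,b)=1$ if $\operatorname{Rank}(M')[a,b)\ge k$ and $0$ otherwise. Let $\mu$ be the Möbius function of $[m+1]^2_<$ ($\mu[x,x]=1$, $\mu[x,y]=-\sum_{x\le y'<y}\mu[x,y']$ for $x<y$), and $(\mu*h)(x)=\sum_{x\le x'}\mu[x,x']h(x')$. Put $\operatorname{PD}(M')=\mu*\operatorname{Rank}(M')$ and $\operatorname{PD}_k(M')=\mu*\operatorname{Rank}_k(M')$. The persistence diagram (resp. $k$-th graded persistence diagram) of $\overline{M'}$ is the function $\mathbb{R}^2_<\to\mathbb{Z}$ whose value at $[\iota(x),\iota(y))$ is $\operatorname{PD}(M')[x,y)$ (resp. $\operatorname{PD}_k(M')[x,y)$) and which is $0$ elsewhere. The persistence diagram is nonnegative. Wasserstein distance. Identify $[x,y)\in\mathbb{R}^2_<$ with the point $(x,y)\in\mathbb{R}^2$ and let $\Delta=\{(x,x):x\in\mathbb{R}\}$. For finitely supported $D,E:\mathbb{R}^2_<\to\mathbb{Z}_{\ge0}$, a coupling is a map $\gamma:(\mathbb{R}^2_<\cup\Delta)\times(\mathbb{R}^2_<\cup\Delta)\to\mathbb{Z}_{\ge0}$ with $\gamma=0$ on $\Delta\times\Delta$, $D(z)=\sum_{w\in\mathbb{R}^2_<\cup\Delta}\gamma(z,w)$ for all $z\in\mathbb{R}^2_<$, and $E(w)=\sum_{z\in\mathbb{R}^2_<\cup\Delta}\gamma(z,w)$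 for all $w\in\mathbb{R}^2_<$. $W_{1,1}(D,E)$ is the infimum over couplings $\gamma$ of $\sum_{(z,w)}\gamma(z,w)\|w-z\|_1$. For finitely supported $A,B:\mathbb{R}^2_<\to\mathbb{Z}$, writing $A=A^+-A^-$, $B=B^+-B^-$ with $A^\pm,B^\pm\ge0$ and $A^+,A^-$ (resp. $B^+,B^-$) of disjoint support, $W_{1,1}(A,B):=W_{1,1}(A^++B^-,\,B^++A^-)$. *)

(* Defs.v *)
From HB Require Import structures.
From mathcomp Require Import all_boot all_order all_algebra.
From mathcomp Require Import boolp classical_sets reals ereal esum.

Set Implicit Arguments.
Unset Strict Implicit.
Unset Printing Implicit Defensive.

Import Order.TTheory GRing.Theory Num.Theory.
Local Open Scope ring_scope.

(** * Persistence modules *)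

Record pmodule (F : fieldType) d (P : porderType d) := PModule {
  pm_obj :> P -> vectType F;
  pm_hom : forall a b : P, (a <= b)%O -> 'Hom(pm_obj a, pm_obj b);
  pm_hom_id : forall (a : P) (h : (a <= a)%O), pm_hom h = \1%VF;
  pm_hom_comp : forall (a b c : P) (ab : (a <= b)%O) (bc : (b <= c)%O)
    (ac : (a <= c)%O), pm_hom ac = (pm_hom bc \o pm_hom ab)%VF }.

Arguments pm_hom {F d P} p {a b}.

Definition rank F d (P : porderType d) (M : pmodule F P) (a b : P)
  (h : (a <= b)%O) : nat := \dim (limg (pm_hom M h)).

Definition pmodule_iso F d (P : porderType d) (M N : pmodule F P) : Prop :=
  exists phi : forall a : P, 'Hom(M a, N a),
    (forall a, bijective (phi a)) /\
    (forall (a b : P) (h : (a <= b)%O),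
       (phi b \o pm_hom M h)%VF = (pm_hom N h \o phi a)%VF).

(** Both [\hat M'] and [\overline{M'}] are the pullback of a module along a
    partial map (values in [option]) that is set to 0 where the map is
    undefined. *)
Section ZeroExtension.
Context (F : fieldType) d (Q : porderType d) (M : pmodule F Q).

Definition zext_obj (o : option Q) : vectType F :=
  if o is Some i then M i else 'rV[F]_0.

Definition opt_le (o1 o2 : option Q) : Prop :=
  forall i j, o1 = Some i -> o2 = Some j -> (i <= j)%O.

Definition zext_hom (o1 o2 : option Q) :
    opt_le o1 o2 -> 'Hom(zext_obj o1, zext_obj o2) :=
  match o1, o2
    return opt_le o1 o2 -> 'Hom(zext_obj o1, zext_obj o2) with
  | Some i, Some j => fun h => pm_hom M (h i j erefl erefl)
  | _, _ => fun=> 0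
  end.

Lemma zext_hom_id (o : option Q) (h : opt_le o o) : zext_hom h = \1%VF.
Proof.
case: o h => [i|] h /=; first exact: pm_hom_id.
by apply/lfunP => x; rewrite !lfunE /=; apply/rowP => -[].
Qed.

Lemma zext_hom_comp (o1 o2 o3 : option Q) (h12 : opt_le o1 o2)
    (h23 : opt_le o2 o3) (h13 : opt_le o1 o3) :
    (isSome o1 -> isSome o3 -> isSome o2) ->
  zext_hom h13 = (zext_hom h23 \o zext_hom h12)%VF.
Proof.
case: o1 o2 o3 h12 h23 h13 => [i|] [j|] [k|] h12 h23 h13 /= hs;
  try (exact: pm_hom_comp);
  try (by have := hs isT isT);
  by apply/lfunP => x; rewrite !(comp_lfunE, lfunE) /= ?linear0 ?lfunE.
Qed.

Context d' (P : porderType d') (f : P -> option Q).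
Hypothesis f_homo : forall a b, (a <= b)%O -> opt_le (f a) (f b).
Hypothesis f_conv : forall a b c, (a <= b)%O -> (b <= c)%O ->
  isSome (f a) -> isSome (f c) -> isSome (f b).

Definition zext : pmodule F P.
refine (@PModule F d' P (fun a => zext_obj (f a))
  (fun a b h => zext_hom (f_homo h)) _ _).
- by move=> a h; exact: zext_hom_id.
- by move=> a b c ab bc ac; apply: zext_hom_comp; exact: f_conv.
Defined.

End ZeroExtension.

Section Hat.
Context (m : nat).

(* [insub] sends [i <= m] to itself and [m + 1] to [None]. *)
Definition hat_idx (i : 'I_m.+2) : option 'I_m.+1 := insub (i : nat).

Lemma hat_idx_homo (a b : 'I_m.+2) :
  (a <= b)%O -> opt_le (hat_idx a) (hat_idx b).
Proof.
rewrite leEord /hat_idx => ab i j.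
case: insubP => // i' _ ei [<-]; case: insubP => // j' _ ej [<-].
by rewrite leEord /= ei ej.
Qed.

Lemma hat_idx_conv (a b c : 'I_m.+2) : (a <= b)%O -> (b <= c)%O ->
  isSome (hat_idx a) -> isSome (hat_idx c) -> isSome (hat_idx b).
Proof.
rewrite !leEord /hat_idx !isSome_insub => _ bc _; exact: leq_ltn_trans.
Qed.

Definition hat (F : fieldType) (M' : pmodule F 'I_m.+1) : pmodule F 'I_m.+2 :=
  zext M' hat_idx_homo hat_idx_conv.

End Hat.

Section Bar.
Context (R : realType) (m : nat) (iota : 'I_m.+2 -> R).

(* The [i] selected is unique; [None] exactly when [a < iota 0] (for an
   order-preserving [iota]). *)
Definition bar_idx (a : R) : option 'I_m.+2 :=
  [pick i | (iota i <= a) && [forall j, (iota j <= a) ==> (j <= i)%O]].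

Lemma bar_idxE (a : R) i : bar_idx a = Some i ->
  iota i <= a /\ forall j, iota j <= a -> (j <= i)%O.
Proof.
rewrite /bar_idx; case: pickP => // k /andP[ka /forallP kmax] [<-].
by split=> // j ja; have := kmax j; rewrite ja.
Qed.

Lemma bar_idxN (a : R) i : iota i <= a -> isSome (bar_idx a).
Proof.
move=> ia; rewrite /bar_idx; case: pickP => // none.
case: (@arg_maxnP _ i (fun j => iota j <= a) (fun j => j : nat)) => // k ka kmax.
have /negP[] := negbT (none k); rewrite ka /=.
by apply/forallP => j; apply/implyP => ja; rewrite leEord; exact: kmax.
Qed.

Lemma bar_idx_homo (a b : R) : (a <= b)%O -> opt_le (bar_idx a) (bar_idx b).
Proof.
move=> ab i j /bar_idxE[ia _] /bar_idxE[_]; apply; exact: le_trans ab.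
Qed.

Lemma bar_idx_conv (a b c : R) : (a <= b)%O -> (b <= c)%O ->
  isSome (bar_idx a) -> isSome (bar_idx c) -> isSome (bar_idx b).
Proof.
move=> ab _; case E: (bar_idx a) => [i|//] _ _.
by have [ia _] := bar_idxE E; exact: bar_idxN (le_trans ia ab).
Qed.

Definition bar (F : fieldType) (M' : pmodule F 'I_m.+1) : pmodule F R :=
  zext (hat M') bar_idx_homo bar_idx_conv.

End Bar.

Definition presented_by (R : realType) (F : fieldType) (M : pmodule F R)
    (m : nat) (M' : pmodule F 'I_m.+1) (iota : 'I_m.+2 -> R) : Prop :=
  [/\ injective iota, {homo iota : i j / (i <= j)%O}
    & pmodule_iso M (bar iota M')].

Definition tame (R : realType) (F : fieldType) (M : pmodule F R) : Prop :=
  exists m (M' : pmodule F 'I_m.+1) iota, presented_by M M' iota.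

Definition max_rank (R : realType) (F : fieldType) (M N : pmodule F R)
    (K : nat) : Prop :=
  (exists (a b : R) (h : (a <= b)%O), rank M h = K \/ rank N h = K) /\
  (forall (a b : R) (h : (a <= b)%O),
     (rank M h <= K)%N /\ (rank N h <= K)%N).

(** * Half-open intervals *)

Definition hoint d (P : porderType d) : Type :=
  {z : P * P | (z.1 < z.2)%O}.

HB.instance Definition _ d (P : porderType d) := Choice.on (hoint P).
HB.instance Definition _ d (P : finPOrderType d) :=
  [Finite of hoint P by <:].

Definition lo d (P : porderType d) (z : hoint P) : P := (val z).1.
Definition hi d (P : porderType d) (z : hoint P) : P := (val z).2.

Section IntervalOrder.
Context d (P : finOrderType d).

Definition hoint_sub (z w : hoint P) : bool :=
  [forall x : P, (lo z <= x < hi z)%O ==> (lo w <= x < hi w)%O].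

Lemma hoint_subE (z w : hoint P) :
  hoint_sub z w = (lo w <= lo z)%O && (hi z <= hi w)%O.
Proof.
apply/forallP/andP => [zw|[l h] x].
- have zlt : (lo z < hi z)%O := valP z.
  have /implyP := zw (lo z); rewrite lexx zlt => /(_ isT)/andP[wz zw'].
  split=> //; rewrite leNgt; apply/negP => hwz.
  have /implyP := zw (hi w).
  by rewrite hwz (ltW zw') ltxx andbF => /(_ isT).
- apply/implyP => /andP[zx xz].
  by rewrite (le_trans l zx) (lt_le_trans xz h).
Qed.

Lemma hoint_sub_refl : reflexive hoint_sub.
Proof. by move=> z; rewrite hoint_subE !lexx. Qed.

Lemma hoint_sub_anti : antisymmetric hoint_sub.
Proof.
move=> z w; rewrite !hoint_subE => /andP[/andP[l1 h1] /andP[l2 h2]].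
apply: val_inj; rewrite [val z]surjective_pairing [val w]surjective_pairing.
by congr pair; apply/le_anti/andP.
Qed.

Lemma hoint_sub_trans : transitive hoint_sub.
Proof.
move=> w z u; rewrite !hoint_subE => /andP[l1 h1] /andP[l2 h2].
by rewrite (le_trans l2 l1) (le_trans h1 h2).
Qed.

Fact hoint_display : Order.disp_t. Proof. exact: Order.Disp tt tt. Qed.

HB.instance Definition _ := Order.Le_isPOrder.Build hoint_display (hoint P)
  hoint_sub_refl hoint_sub_anti hoint_sub_trans.

End IntervalOrder.

(** * Möbius inversion *)

Section Mobius.
Context d (T : finPOrderType d).

(* The recursion is well-founded on the finite poset [T]; the fuel [#|T|]
   suffices, see [mobiusE] below. *)
Fixpoint mobius_rec (n : nat) (x y : T) : int :=
  if x == y then 1 else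
  if n is n'.+1 then
    if (x < y)%O then - \sum_(z | (x <= z < y)%O) mobius_rec n' x z else 0
  else 0.

Definition mobius (x y : T) : int := mobius_rec #|T| x y.

Lemma mobius_rec_stable n n' (x y : T) :
  (#|[pred z | (x <= z < y)%O]| <= n)%N ->
  (#|[pred z | (x <= z < y)%O]| <= n')%N ->
  mobius_rec n x y = mobius_rec n' x y.
Proof.
elim: n n' y => [|n IH] n' y.
  move=> c0; case: n' => [//|n'] _ /=.
  case: eqVneq => // _; case: ifP => // xy.
  move: c0; rewrite leqn0 => /eqP/card0_eq/(_ x).
  by rewrite !inE lexx xy.
case: n' => [|n'] c c' /=; case: eqVneq => // _; case: ifP => // xy.
  move: c'; rewrite leqn0 => /eqP/card0_eq/(_ x).
  by rewrite !inE lexx xy.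
congr (- _); apply: eq_bigr => z /andP[xz zy].
have lt : (#|[pred u | (x <= u < z)%O]| < #|[pred u | (x <= u < y)%O]|)%N.
  apply/proper_card/properP; split.
    by apply/fintype.subsetP => u; rewrite !inE => /andP[-> /lt_trans->].
  by exists z; rewrite !inE ?xz ?zy // ltxx andbF.
by apply: IH; rewrite -ltnS; exact: leq_trans lt _.
Qed.

Lemma mobius_id (x : T) : mobius x x = 1.
Proof. by rewrite /mobius; case: #|T| => [|n] /=; rewrite eqxx. Qed.

Lemma mobiusE (x y : T) : (x < y)%O ->
  mobius x y = - \sum_(z | (x <= z < y)%O) mobius x z.
Proof.
move=> xy; have T0 : (0 < #|T|)%N by apply/card_gt0P; exists x.
transitivity (mobius_rec #|T|.+1 x y).
  by apply: mobius_rec_stable; rewrite ?leqW // max_card.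
by rewrite /= (lt_eqF xy) xy.
Qed.

Definition mobius_conv (h : T -> int) (x : T) : int :=
  \sum_(x' | (x <= x')%O) mobius x x' * h x'.

End Mobius.

(** * Persistence diagrams *)

Section Diagrams.
Context (F : fieldType) (m : nat) (M' : pmodule F 'I_m.+1).

Lemma hoint_pred_le (z : hoint 'I_m.+2) :
  ((inord (lo z) : 'I_m.+1) <= inord (hi z).-1)%O.
Proof.
have : (lo z < hi z)%O := valP z.
have := ltn_ord (hi z); case: (hi z) (lo z) => [[|b] ?] [a ?] //=.
rewrite ltEord leEord /= !ltnS => hb ab.
by rewrite !inordK // ltnS (leq_trans ab).
Qed.

Definition Rank (z : hoint 'I_m.+2) : nat := rank M' (hoint_pred_le z).

Definition Rank_k (k : nat) (z : hoint 'I_m.+2) : int :=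
  if (k <= Rank z)%N then 1 else 0.

Definition PD : hoint 'I_m.+2 -> int := mobius_conv (fun z => (Rank z)%:Z).

Definition PD_k (k : nat) : hoint 'I_m.+2 -> int := mobius_conv (Rank_k k).

End Diagrams.

Definition push_diagram (R : realType) (m : nat) (iota : 'I_m.+2 -> R)
    (f : hoint 'I_m.+2 -> int) (z : hoint R) : int :=
  if [pick w | (iota (lo w) == lo z) && (iota (hi w) == hi z)] is Some w
  then f w else 0.

Definition persistence_diagram (R : realType) (F : fieldType)
    (M : pmodule F R) (D : hoint R -> int) : Prop :=
  exists m (M' : pmodule F 'I_m.+1) iota,
    presented_by M M' iota /\ D =1 push_diagram iota (PD M').

Definition graded_persistence_diagram (R : realType) (F : fieldType)
    (M : pmodule F R) (k : nat) (D : hoint R -> int) : Prop :=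
  exists m (M' : pmodule F 'I_m.+1) iota,
    presented_by M M' iota /\ D =1 push_diagram iota (PD_k M' k).

(** * Wasserstein distance *)

Section Wasserstein.
Context (R : realType).

(* The disjoint union of [R^2_<] and the diagonal; [inr x] is [(x, x)]. *)
Definition dpoint : Type := (hoint R + R)%type.
HB.instance Definition _ := Choice.on dpoint.

Definition coords (p : dpoint) : R * R :=
  match p with inl z => (lo z, hi z) | inr x => (x, x) end.

Definition dist1 (p q : dpoint) : R :=
  `|(coords q).1 - (coords p).1| + `|(coords q).2 - (coords p).2|.

Local Open Scope ereal_scope.

(* The sums range over uncountable types, hence are taken in [\bar R]; all
   their terms are nonnegative. *)
Definition coupling (D E : hoint R -> nat) (g : dpoint -> dpoint -> nat) :
    Prop :=
  [/\ forall x y : R, g (inr x) (inr y) = 0%N,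
      forall z, (D z)%:R%:E = \esum_(w in setT) (g (inl z) w)%:R%:E :> \bar R
    & forall w, (E w)%:R%:E = \esum_(z in setT) (g z (inl w))%:R%:E :> \bar R].

Definition cost (g : dpoint -> dpoint -> nat) : \bar R :=
  \esum_(p in setT) ((g p.1 p.2)%:R * dist1 p.1 p.2)%:E.

Definition W11_nat (D E : hoint R -> nat) : \bar R :=
  ereal_inf [set cost g | g in [set g | coupling D E g]].

Definition pos_part (A : hoint R -> int) (z : hoint R) : nat :=
  `|Order.max (A z) 0|%N.
Definition neg_part (A : hoint R -> int) (z : hoint R) : nat :=
  `|Order.max (- A z)%R 0|%N.

(* On nonnegative [A] and [B] the negative parts vanish, and this is the
   unsigned distance [W11_nat]. *)
Definition W11 (A B : hoint R -> int) : \bar R :=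
  W11_nat (fun z => (pos_part A z + neg_part B z)%N)
          (fun z => (pos_part B z + neg_part A z)%N).

End Wasserstein.

(* Main.v *)
Require Import Defs.
From mathcomp Require Import all_boot all_order all_algebra.
From mathcomp Require Import boolp classical_sets reals ereal esum.
From mathcomp Require Import zify lra.

Set Implicit Arguments.
Unset Strict Implicit.
Unset Printing Implicit Defensive.

Import Order.TTheory GRing.Theory Num.Theory.
Local Open Scope ring_scope.

(** Let [G_k] be the diagram of the truncated rank function [max (rank - k) 0].
    As [Rank_k] is the difference of the truncations at [k - 1] and at [k], Möbius
    inversion gives [D_k = G_(k-1) - G_k], and [G_0] is the persistence diagram
    [D]. All the bounds follow from one fact: passing from [D] to [G_k] does not
    increase the Wasserstein distance. Bound (i) is then a sum of two such
    estimates, one for [G_(k-1)] and one for [G_k]. When no rank exceeds [K] the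
    diagrams [G_K] vanish, so that [D_K = G_(K-1)]: this gives (ii) with a single
    estimate, and (iii).

    It is enough to pass from [D] to [G_1] and to iterate. For this, sort the
    points of [D] by birth and scan them while carrying the largest death met so
    far: at a point [(x, y)] with carry [c], emit [(x, min c y)] and carry
    [max c y] ([bump]). At every time this removes exactly one of the intervals
    alive, the one that dies last, hence lowers every positive rank by one
    ([bump_cnt]). The map [(c, y) -> (min c y, max c y)] does not expand the l1
    distance, so that moving the death of one point costs no more after the scan
    than before ([bump_vertical]). A point whose birth moves to the right travels
    freely until it meets the birth of its neighbour; there the order of the two
    in the scan does not matter ([bump_tie]), so they change places and the point
    goes on ([bump_right]). Moving the points of [D] one by one to their partners
    in [E] gives [bump_nonexpansive].

    All this is done with finite lists of points of the plane. A point on or below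
    the diagonal stands for the diagonal: it is invisible to the ranks, and
    replacing it by a point of the diagonal does not raise the cost of a pair
    ([to_dpoints]). Conversely a coupling of finitely supported functions is a
    finite list of pairs ([coupling_list]). The signed distance compares
    [D_k^+ + E_k^-] with [E_k^+ + D_k^-]. With [G'_k] for the truncations of [E],
    the diagrams [G_(k-1) + G'_k] and [G'_(k-1) + G_k] exceed these two by the same
    diagram, and common points can be cancelled in a matching because the cost
    satisfies the triangle inequality ([matched_cancel]).

    On the algebraic side, the persistence diagram is nonnegative by the Frobenius
    rank inequality ([rank_frobenius]), and diagrams that come from different
    presentations of a module agree because the ranks determine the points off the
    diagonal ([cnt_inj]).

    For sharpness take the intervals [0, 3) and [1, 5), and move the birth of the
    second from 1 to 2. This costs 1. In the second graded diagram only the point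
    (1, 3) moves, to (2, 3), but in the first one the point (1, 5) and the negative
    point (1, 3) both move. *)

(** * Matchings of finite lists of points of the plane *)

Section Matchings.
Context (R : realFieldType).
Implicit Types (p q : R * R) (s t u v : seq (R * R)).
Implicit Types (l : seq ((R * R) * (R * R))).

Definition l1dist p q : R := `|q.1 - p.1| + `|q.2 - p.2|.

Definition mcost l : R := \sum_(e <- l) l1dist e.1 e.2.

(** The points may lie anywhere in the plane, and none is left unmatched: a match
    with the diagonal is a match with a point on or below it. *)
Definition matched s t (c : R) : Prop :=
  exists l, [/\ perm_eq (unzip1 l) s, perm_eq (unzip2 l) t & mcost l <= c].

Lemma l1distC p q : l1dist p q = l1dist q p.
Proof. by rewrite /l1dist distrC [X in _ + X]distrC. Qed.

Lemma l1dist_triangle p q r : l1dist p r <= l1dist p q + l1dist q r.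
Proof.
rewrite /l1dist addrACA lerD // [leRHS]addrC; exact: ler_distD.
Qed.

Lemma matched_perm s s' t t' c :
  perm_eq s s' -> perm_eq t t' -> matched s t c -> matched s' t' c.
Proof.
move=> ss tt [l [ls lt lc]]; exists l.
by split; [apply: perm_trans ls ss|apply: perm_trans lt tt|].
Qed.

Lemma matched_le s t c c' : c <= c' -> matched s t c -> matched s t c'.
Proof. by move=> cc [l [ls lt lc]]; exists l; split=> //; exact: le_trans cc. Qed.

Lemma matched_refl s : matched s s 0.
Proof.
exists [seq (p, p) | p <- s]; split.
- by rewrite /unzip1 -map_comp map_id.
- by rewrite /unzip2 -map_comp map_id.
by rewrite /mcost big_map big1 // => p _; rewrite /l1dist !subrr normr0 addr0.
Qed.

Lemma matched_sym s t c : matched s t c -> matched t s c.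
Proof.
move=> [l [ls lt lc]]; exists [seq (e.2, e.1) | e <- l]; split.
- by rewrite /unzip1 -map_comp.
- by rewrite /unzip2 -map_comp.
by rewrite /mcost big_map; under eq_bigr do rewrite l1distC.
Qed.

Lemma matched_cat s t s' t' c c' :
  matched s t c -> matched s' t' c' -> matched (s ++ s') (t ++ t') (c + c').
Proof.
move=> [l [ls lt lc]] [l' [ls' lt' lc']]; exists (l ++ l'); split.
- by rewrite /unzip1 map_cat perm_cat.
- by rewrite /unzip2 map_cat perm_cat.
by rewrite /mcost big_cat lerD.
Qed.

Lemma matched_cons p q s t c c' :
  l1dist p q <= c -> matched s t c' -> matched (p :: s) (q :: t) (c + c').
Proof.
move=> pq; apply: (@matched_cat [:: p] [:: q]).
by exists [:: (p, q)]; rewrite /mcost big_seq1 !perm_refl.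
Qed.

Lemma matched_same p s t c : matched s t c -> matched (p :: s) (p :: t) c.
Proof. by rewrite -{2}[c]add0r; apply: matched_cons; rewrite /l1dist !subrr normr0 addr0. Qed.

(** Reordering the second matching aligns the middle list of both. *)
Lemma matched_trans s t u c c' :
  matched s t c -> matched t u c' -> matched s u (c + c').
Proof.
move=> [l [ls lt lc]] [l' [lt' lu lc']].
have /(perm_iotaP 0)[Is Isp E] : perm_eq (unzip2 l) (unzip1 l').
  by apply: perm_trans lt _; rewrite perm_sym.
pose l2 := [seq nth (0, 0) l' i | i <- Is].
have l2p : perm_eq l2 l'.
  by apply/(perm_iotaP (0, 0)); exists Is => //; rewrite -(size_map fst).
have {}E : unzip2 l = unzip1 l2.
  rewrite E /unzip1 /l2 -map_comp; apply/eq_in_map => i iIs /=.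
  rewrite (nth_map (0, 0)) //.
  by move: iIs; rewrite (perm_mem Isp) mem_iota size_map.
have {}lu : perm_eq (unzip2 l2) u by apply: perm_trans lu; exact: perm_map.
have {}lc' : mcost l2 <= c' by rewrite /mcost (perm_big _ l2p).
apply: (matched_perm ls lu); apply: matched_le (lerD lc lc') _.
elim: l l2 {ls lt lc lc' lu l2p Isp} E => [|[a b] l IH] [|[b' d] l2] //=.
  by move=> _; rewrite /mcost big_nil addr0; exact: matched_refl.
move=> [<- /IH{}IH]; rewrite /mcost !big_cons addrACA /=.
by apply: matched_cons => //; exact: l1dist_triangle.
Qed.

(** A common point [z] is removed by composing the pair that leaves [z] with the
    pair that reaches it. *)
Lemma matched_cancel1 z s t c : matched (z :: s) (z :: t) c -> matched s t c.
Proof.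
move=> [l [ls lt lc]].
have : z \in unzip1 l by rewrite (perm_mem ls) mem_head.
case/mapP=> -[z' w] /= /perm_to_rem + ?; subst z'; set l1 := rem _ l => E1.
have {}ls : perm_eq (unzip1 l1) s.
  rewrite -(perm_cons z); apply: perm_trans ls; rewrite perm_sym.
  exact: (perm_map fst E1).
have {}lt : perm_eq (w :: unzip2 l1) (z :: t).
  apply: perm_trans lt; rewrite perm_sym; exact: (perm_map snd E1).
have {}lc : l1dist z w + mcost l1 <= c.
  by move: lc; rewrite /mcost (perm_big _ E1) big_cons.
have [wz|wz] := eqVneq w z.
  exists l1; split=> //; first by move: lt; rewrite wz perm_cons.
  by apply: le_trans lc; rewrite lerDr addr_ge0.
have : z \in unzip2 l1.
  have : z \in w :: unzip2 l1 by rewrite (perm_mem lt) mem_head.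
  by rewrite inE eq_sym (negPf wz).
case/mapP=> -[x z'] /= /perm_to_rem + ?; subst z'; set l2 := rem _ l1 => E2.
exists ((x, w) :: l2); split.
- by apply: perm_trans ls; rewrite perm_sym; exact: (perm_map fst E2).
- rewrite -(perm_cons z); apply: perm_trans lt.
  rewrite /= -cat1s perm_catC /= -[_ :: (_ ++ _)]/([:: w] ++ _) perm_cat2l.
  rewrite perm_catC; rewrite perm_sym; exact: (perm_map snd E2).
apply: le_trans lc; rewrite /mcost (perm_big _ E2) !big_cons /= addrA lerD2r.
by rewrite addrC; exact: l1dist_triangle.
Qed.

Lemma matched_cancel r s t c : matched (r ++ s) (r ++ t) c -> matched s t c.
Proof. by elim: r => //= z r IH /matched_cancel1/IH. Qed.

End Matchings.


(** * Removing the longest interval at each birth *)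

Section Truncation.
Context (R : realFieldType).
Implicit Types (p q : R * R) (s t u v : seq (R * R)).

(** For [a < b] this is the number of intervals [[x, y)] of the list that contain
    [[a, b)]; the points on or below the diagonal are not seen. *)
Definition cnt s (a b : R) : nat := count (fun p => (p.1 <= a) && (b <= p.2)) s.

Definition xle p q := p.1 <= q.1.

(** On a list sorted by birth, [c] is the largest death met so far. *)
Fixpoint bump (c : R) s :=
  if s is p :: s' then (p.1, Num.min c p.2) :: bump (Num.max c p.2) s' else [::].

Lemma bump_fst c s : unzip1 (bump c s) = unzip1 s.
Proof. by elim: s c => //= p s IH c; rewrite IH. Qed.

Lemma bump_snd c s : {subset unzip2 (bump c s) <= c :: unzip2 s}.
Proof.
elim: s c => //= p s IH c y; rewrite !inE => /orP[/eqP->|/IH].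
  by rewrite /Num.min; case: ifP; rewrite eqxx ?orbT.
by rewrite !inE /Num.max; case: ifP => _ /orP[->|->]; rewrite ?orbT.
Qed.

Lemma xle_trans : transitive xle.
Proof. by move=> q p r; rewrite /xle; exact: le_trans. Qed.

Lemma xle_total : total xle.
Proof. by move=> p q; rewrite /xle; exact: le_total. Qed.

(** Among the points born by time [a], [bump] removes the highest death: it
    carries the maximum seen so far and emits the others. *)
Lemma bump_cnt c s a b : sorted xle s ->
  cnt (bump c s) a b = if b <= c then cnt s a b else (cnt s a b).-1.
Proof.
elim: s c => [|p s IH] c; first by rewrite /cnt /= if_same.
rewrite /= => ps; have ss := path_sorted ps.
rewrite /cnt /= -!/(cnt _ _ _) IH //=.
have [pa|ap] /= := leP p.1 a.
  rewrite le_min le_max.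
  by case: (b <= c); case: (b <= p.2); rewrite ?addn0 ?add0n ?add1n ?if_same.
suff -> : cnt s a b = 0%N by rewrite !if_same.
apply/eqP; rewrite -leqn0 leqNgt -has_count; apply/hasPn => q qs.
have : xle p q by apply: (allP (order_path_min xle_trans ps)).
by rewrite /xle negb_and -ltNge => pq; rewrite (lt_le_trans ap pq).
Qed.

(** The comparator [(c, y) -> (min c y, max c y)] preserves the l1 distance of two
    inputs that differ in one coordinate. *)
Lemma minmax_dist (c c' y : R) :
  `|Num.min c' y - Num.min c y| + `|Num.max c' y - Num.max c y| = `|c' - c|.
Proof.
rewrite /Num.min /Num.max; case: ltP => h1; case: ltP => h2;
  rewrite ?subrr ?normr0 ?addr0 ?add0r //.
- rewrite ler0_norm ?subr_le0 ?(ltW h1) // ler0_norm ?subr_le0 //.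
  by rewrite ler0_norm ?subr_le0 ?(le_trans (ltW h1)) // !opprB addrC subrKA.
- rewrite ger0_norm ?subr_ge0 ?(ltW h2) // ger0_norm ?subr_ge0 //.
  by rewrite ger0_norm ?subr_ge0 ?(le_trans (ltW h2)) // addrC subrKA.
Qed.

(** Each comparator leaves a part of the distance of the carries in the output and
    passes the rest on. *)
Lemma bump_carry c c' s : matched (bump c s) (bump c' s) `|c' - c|.
Proof.
elim: s c c' => [|p s IH] c c' /=.
  by apply: matched_le (normr_ge0 _) _; exact: matched_refl.
rewrite -(minmax_dist _ _ p.2); apply: matched_cons => //.
by rewrite /l1dist /= subrr normr0 add0r.
Qed.

(** From the moved point on, only the carries differ. *)
Lemma bump_vertical c s x y y' t :
  matched (bump c (s ++ (x, y) :: t)) (bump c (s ++ (x, y') :: t)) `|y' - y|.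
Proof.
elim: s c => [|p s IH] c /=; last exact/matched_same/IH.
rewrite -(minmax_dist _ _ c) !(minC c) !(maxC c).
apply: matched_cons; last exact: bump_carry.
by rewrite /l1dist /= subrr normr0 add0r.
Qed.

(** Whatever the order, the two smallest of [c], [y] and [y1] are emitted. *)
Lemma bump_tie c x y y1 s :
  perm_eq (bump c ((x, y) :: (x, y1) :: s)) (bump c ((x, y1) :: (x, y) :: s)).
Proof.
have swap p q r : perm_eq [:: p, q & r] [:: q, p & r].
  by rewrite (perm_catCA [:: p] [:: q]).
rewrite /= !(maxAC c y y1).
case: (leP y c) => h1; case: (leP y1 c) => h2 //=.
- by rewrite (min_r h1).
- by rewrite (min_r (le_trans h1 (ltW h2))).
- by rewrite (min_r (le_trans h2 (ltW h1))) (min_l (ltW h1)).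
- by rewrite (minC y1).
Qed.

(** A point moving right reaches its next neighbour, changes places with it
    (at equal births the order does not matter) and goes on. *)
Lemma bump_right c x x' y s t : path xle (x, y) (rcons s (x', y)) ->
  matched (bump c ((x, y) :: s ++ t)) (bump c (s ++ (x', y) :: t)) (x' - x).
Proof.
elim: s c x => [|[x1 y1] s IH] c x /=.
  rewrite /xle /= andbT => xx; rewrite -[x' - x]addr0; apply: matched_cons.
    by rewrite /l1dist /= subrr normr0 addr0 ger0_norm ?subr_ge0.
  exact: matched_refl.
rewrite {1}/xle /= => /andP[xx1 hp].
have {}hp : path xle (x1, y) (rcons s (x', y)) by case: (s) hp.
have -> : x' - x = (x1 - x) + 0 + 0 + (x' - x1) by lra.
apply: (@matched_trans _ _ (bump c [:: (x1, y1), (x1, y) & s ++ t])).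
  apply: matched_trans (matched_perm (perm_refl _) (bump_tie _ _ _ _ _)
    (matched_refl _)).
  apply: matched_cons; last exact: matched_refl.
  by rewrite /l1dist /= subrr normr0 addr0 ger0_norm ?subr_ge0.
by apply: matched_same; exact: IH.
Qed.


Lemma sorted_insert s p t : sorted xle (s ++ p :: t) =
  [&& all (xle^~ p) s, all (xle p) t & sorted xle (s ++ t)].
Proof.
rewrite !(sorted_pairwise xle_trans) !pairwise_cat /= allrel_consr.
by case: (all _ s) (all _ t) (allrel _ s t) => [] [] [] //=; rewrite andbF.
Qed.

Lemma sorted_split p t : sorted xle t ->
  t = [seq q <- t | xle q p] ++ [seq q <- t | ~~ xle q p].
Proof.
elim: t => //= q t IH qt; have [_|pq] /= := boolP (xle q p).
  by rewrite -IH // (path_sorted qt).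
have qm := allP (order_path_min xle_trans qt).
have tp : {in t, forall r, xle r p = false}.
  by move=> r /qm qr; apply: contraNF pq; exact: xle_trans.
rewrite (eq_in_filter tp) filter_pred0 /=; congr (_ :: _).
by apply/esym/all_filterP/allP => r /tp ->.
Qed.

Lemma all_not_xle p t : all (xle p) [seq q <- t | ~~ xle q p].
Proof.
apply/allP => q; rewrite mem_filter => /andP[+ _].
by have /orP[->|->] := xle_total q p.
Qed.

(** [t1] consists of the points that [p] passes on its way to [q]. *)
Lemma insert_right s p q t : xle p q -> sorted xle (s ++ p :: t) ->
  exists t1 t2, [/\ t = t1 ++ t2, path xle p (rcons t1 q)
    & sorted xle (s ++ t1 ++ q :: t2)].
Proof.
move=> pq; rewrite sorted_insert => /and3P[sp pt st].
have tt : sorted xle t by move/cat_sorted2: st => [].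
have E := sorted_split q tt; move: E pt st.
have: all (xle^~ q) [seq r <- t | xle r q] by exact: filter_all.
have := all_not_xle q t; set t1 := seq.filter (xle^~ q) t; set t2 := seq.filter _ t.
move=> qt2 t1q -> pt st; exists t1, t2; split=> //.
  rewrite (path_sortedE xle_trans) all_rcons pq /=.
  move: pt; rewrite all_cat => /andP[-> _]; rewrite -cats1 sorted_insert t1q /= cats0.
  by move/cat_sorted2: st => [_ /cat_sorted2[]].
rewrite catA sorted_insert all_cat t1q qt2 -catA st !andbT.
by apply: sub_all sp => r /xle_trans; apply.
Qed.

Lemma insert_left s p q t : xle q p -> sorted xle (s ++ p :: t) ->
  exists s1 s2, [/\ s = s1 ++ s2, path xle q (rcons s2 p)
    & sorted xle (s1 ++ q :: s2 ++ t)].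
Proof.
move=> qp; rewrite sorted_insert => /and3P[sp pt st].
have ss : sorted xle s by move/cat_sorted2: st => [].
have E := sorted_split q ss; move: E sp st.
have: all (xle^~ q) [seq r <- s | xle r q] by exact: filter_all.
have := all_not_xle q s; set s1 := seq.filter (xle^~ q) s; set s2 := seq.filter _ s.
move=> qs2 s1q -> sp st; exists s1, s2; split=> //.
  rewrite (path_sortedE xle_trans) all_rcons qp qs2 /= -cats1 sorted_insert.
  move: sp; rewrite all_cat => /andP[_ ->] /=; rewrite cats0.
  by move/cat_sorted2: st => [/cat_sorted2[]].
rewrite sorted_insert s1q all_cat qs2 catA st andbT.
by apply: sub_all pt => r; exact: xle_trans.
Qed.

(** The point moves first in death, then in birth. *)
Lemma bump_move1 c s p q t : sorted xle (s ++ p :: t) ->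
  exists a, [/\ sorted xle a, perm_eq a (q :: s ++ t)
    & matched (bump c (s ++ p :: t)) (bump c a) (l1dist p q)].
Proof.
move=> st; rewrite /l1dist addrC; case: p q st => [x y] [x' y'] /= st.
have {}st : sorted xle (s ++ (x, y') :: t).
  by move: st; rewrite !sorted_insert.
have V := bump_vertical c s x y y' t.
have [xx|/ltW xx] := leP x x'.
  have [t1 [t2 [Et hp sa]]] := @insert_right s (x, y') (x', y') t xx st.
  exists (s ++ t1 ++ (x', y') :: t2); split=> //.
    by rewrite Et !catA -cat1s perm_catCA.
  apply: matched_trans V _; rewrite Et ger0_norm ?subr_ge0 //.
  elim: s c {st sa} => [|r s IH] c /=; first exact: bump_right.
  exact/matched_same/IH.
have [s1 [s2 [Es hp sa]]] := @insert_left s (x, y') (x', y') t xx st.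
exists (s1 ++ (x', y') :: s2 ++ t); split=> //.
  by rewrite Es -catA -cat1s perm_catCA.
apply: matched_trans V _; rewrite Es ler0_norm ?subr_le0 // opprB -catA.
apply: matched_sym; elim: s1 c {st sa Es} => [|r s1 IH] c /=.
  exact: bump_right.
exact/matched_same/IH.
Qed.

(** The points are moved one after the other, so that every intermediate list
    is known exactly and the costs add up. *)
Lemma bump_nonexpansive c (l : seq ((R * R) * (R * R))) r a :
  sorted xle a -> perm_eq a (unzip1 l ++ r) ->
  exists b, [/\ sorted xle b, perm_eq b (unzip2 l ++ r)
    & matched (bump c a) (bump c b) (mcost l)].
Proof.
elim: l r a => [|[p q] l IH] r a sa pa.
  by exists a; split=> //; rewrite /mcost big_nil; exact: matched_refl.
have pin : p \in a by rewrite (perm_mem pa) mem_head.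
case/splitPr: pin sa pa => a1 a2 sa pa.
have {}pa : perm_eq (a1 ++ a2) (unzip1 l ++ r).
  rewrite -(perm_cons p); apply: perm_trans pa.
  by rewrite -[p :: a1 ++ a2]cat1s -[p :: a2]cat1s perm_catCA.
have [a' [sa' pa' m1]] := bump_move1 c q sa.
have [|b [sb pb m2]] := IH (q :: r) a' sa'.
  by apply: (perm_trans pa'); rewrite -[q :: r]cat1s perm_sym perm_catCA perm_cons perm_sym.
exists b; split=> //; last by rewrite /mcost big_cons; exact: matched_trans m1 m2.
by apply: (perm_trans pb); rewrite -[q :: r]cat1s perm_catCA.
Qed.


Definition offdiag p := p.1 < p.2.

(** [u] represents the rank function of [s] lowered by [k]. *)
Definition truncation k s u := forall a b, a < b -> cnt u a b = (cnt s a b - k)%N.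

Lemma cnt_perm s t a b : perm_eq s t -> cnt s a b = cnt t a b.
Proof. by move/permP; apply. Qed.

Lemma cnt_eq0 s a b : {in unzip1 s, forall x, a < x} -> cnt s a b = 0%N.
Proof.
move=> sa; apply/eqP; rewrite -leqn0 leqNgt -has_count; apply/hasPn => p ps.
by rewrite negb_and -ltNge sa ?map_f.
Qed.

Lemma bump_truncation L s : {in unzip1 s, forall x, L <= x} -> sorted xle s ->
  truncation 1 s (bump L s).
Proof.
move=> Ls ss a b ab; rewrite bump_cnt // subn1; case: leP => // bL.
rewrite cnt_eq0 // => x /Ls; exact: lt_le_trans (lt_le_trans ab bL).
Qed.

Lemma truncation_trans k k' s t u :
  truncation k s t -> truncation k' t u -> truncation (k + k') s u.
Proof. by move=> st tu a b ab; rewrite tu // st // subnDA. Qed.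

Lemma bump_coords L (X Y : seq R) u :
  {in u, forall p, p.1 \in X /\ p.2 \in L :: Y} ->
  {in bump L u, forall p, p.1 \in X /\ p.2 \in L :: Y}.
Proof.
move=> uXY p pu; split.
  have := map_f fst pu; rewrite [map _ _]bump_fst => /mapP[q qu ->].
  by have [] := uXY q qu.
have := bump_snd (map_f snd pu); rewrite inE => /orP[/eqP->|/mapP[q qu ->]].
  exact: mem_head.
by have [] := uXY q qu.
Qed.

(** [L] is the initial carry of the iterated [bump]s; a point with death [L] is
    on or below the diagonal. *)
Lemma truncation_iter L k s t c : {in unzip1 s ++ unzip1 t, forall x, L <= x} ->
  matched s t c -> exists u v, [/\ matched u v c,
    truncation k s u, truncation k t v,
    {in u, forall p, p.1 \in unzip1 s /\ p.2 \in L :: unzip2 s}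
    & {in v, forall p, p.1 \in unzip1 t /\ p.2 \in L :: unzip2 t}].
Proof.
move=> Lst m; elim: k => [|k [u [v [[l [lu lv lc]] su tv us vt]]]].
  exists s, t; split=> // [a b _|a b _|p ps|p pt]; rewrite ?subn0 //;
    by rewrite inE !map_f ?orbT.
have ub := sort_sorted xle_total u; set a := sort _ u in ub.
have ua : perm_eq a u by rewrite perm_sort.
have [|b [sb vb mb]] := @bump_nonexpansive L l [::] a ub.
  by rewrite cats0 (permPl ua) perm_sym.
rewrite cats0 in vb; have {}vb := perm_trans vb lv.
have {}us : {in a, forall p, p.1 \in unzip1 s /\ p.2 \in L :: unzip2 s}.
  by move=> p; rewrite (perm_mem ua); exact: us.
have {}vt : {in b, forall p, p.1 \in unzip1 t /\ p.2 \in L :: unzip2 t}.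
  by move=> p; rewrite (perm_mem vb); exact: vt.
exists (bump L a), (bump L b); split.
- exact: matched_le mb.
- rewrite -addn1; apply: truncation_trans su _ => x y xy.
  rewrite bump_truncation ?(cnt_perm _ _ ua) // => _ /mapP[p pa ->].
  by apply: Lst; rewrite mem_cat; have [->] := us p pa.
- rewrite -addn1; apply: truncation_trans tv _ => x y xy.
  rewrite bump_truncation ?(cnt_perm _ _ vb) // => _ /mapP[p pb ->].
  by apply: Lst; rewrite mem_cat; have [->] := vt p pb; rewrite orbT.
- exact: bump_coords.
- exact: bump_coords.
Qed.

Lemma exists_lower_bound (w : seq R) : exists L, {in w, forall x, L <= x}.
Proof.
elim: w => [|x w [L Lw]]; first by exists 0.
exists (Num.min x L) => y; rewrite inE ge_min => /orP[/eqP->|/Lw ->].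
  by rewrite lexx.
by rewrite orbT.
Qed.

Lemma truncation_matched k s t c : matched s t c ->
  exists u v, [/\ matched u v c, truncation k s u & truncation k t v].
Proof.
move=> m; have [L Lst] := exists_lower_bound (unzip1 s ++ unzip1 t).
by have [u [v []]] := truncation_iter k Lst m; exists u, v.
Qed.

(** A scan only recombines the births and deaths that are present; the initial
    carry ends up on or below the diagonal. *)
Lemma truncation_grid k s : exists u, truncation k s u /\
  {in u, forall p, offdiag p -> p.1 \in unzip1 s /\ p.2 \in unzip2 s}.
Proof.
have [L Ls] := exists_lower_bound (unzip1 s ++ unzip1 s).
have [u [_ [_ su _ us _]]] := truncation_iter k Ls (matched_refl s).
exists u; split=> // p /us[p1]; rewrite inE => /orP[/eqP pL|//].
by rewrite /offdiag pL ltNge Ls // mem_cat p1.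
Qed.

Lemma eq_count_mem (P : pred (R * R)) u v :
  (forall p, P p -> count_mem p u = count_mem p v) -> count P u = count P v.
Proof.
move=> uv; rewrite -!size_filter; apply: perm_size; apply/allP => p _ /=.
have cf w : count_mem p (seq.filter P w) = (P p * count_mem p w)%N.
  elim: w => [|q w IH]; first by rewrite muln0.
  rewrite /= mulnDr -{}IH; have [->|qp] := eqVneq q p.
    by case: (P p); rewrite /= ?eqxx.
  by case: (P q); rewrite /= ?(negPf qp) ?muln0.
by rewrite !cf; case: (boolP (P p)) => // /uv ->.
Qed.

(** The multiplicity of [p] is the count at [p] minus the multiplicities of the
    strictly larger intervals, which are longer: induction on length. *)
Lemma cnt_inj u v : (forall a b, a < b -> cnt u a b = cnt v a b) ->
  forall p, offdiag p -> count_mem p u = count_mem p v.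
Proof.
move=> uv p; pose len q := q.2 - q.1.
have [n] := ubnP (count (fun q => len p < len q) (u ++ v)).
elim: n p => // n IH p; rewrite ltnS => pn op.
have := uv _ _ op.
pose P q := [&& q.1 <= p.1, p.2 <= q.2 & q != p].
have split_cnt w : cnt w p.1 p.2 = (count_mem p w + count P w)%N.
  rewrite /cnt; elim: w => //= q w ->; rewrite /P.
  by have [->|_] := eqVneq q p; rewrite ?lexx ?andbT /=; lia.
have eqP_uv : count P u = count P v.
  apply: eq_count_mem => q /and3P[q1 q2 qp].
  have oq : offdiag q by apply: le_lt_trans q1 (lt_le_trans op q2).
  have pq : len p < len q.
    rewrite ltNge; apply: contra qp; rewrite /len => qp.
    by rewrite -pair_eqE; apply/andP; split; apply/eqP; lra.
  have [quv|] := boolP (q \in u ++ v); last first.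
    rewrite mem_cat => /norP[qu qv].
    by rewrite (count_memPn qu) (count_memPn qv).
  apply: IH => //; apply: leq_trans pn.
  have /permP E := perm_to_rem quv; rewrite !E /= ltxx pq.
  by rewrite add0n add1n ltnS; apply: sub_count => r; exact: lt_trans.
by rewrite !split_cnt eqP_uv => /addIn.
Qed.

Definition cnt_open s (a b : R) : nat :=
  count (fun p => (p.1 <= a) && (b < p.2)) s.

(** The deaths being finite in number, some [b' < b] has no death in between: [cnt]
    at [b] is the left limit of [cnt_open]. *)
Lemma cnt_openE s t a b : a < b -> exists b', [/\ a <= b',
  cnt s a b = cnt_open s a b' & cnt t a b = cnt_open t a b'].
Proof.
move=> ab.
have [b' [ab' /allP bb']] : exists b', a <= b' /\
    all (fun p => (b <= p.2) == (b' < p.2)) (s ++ t).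
  have {ab} : exists b', [/\ a <= b', b' < b &
      all (fun p => (b <= p.2) == (b' < p.2)) (s ++ t)].
    elim: (s ++ t) => [|p w [b' [ab' b'b wb']]]; first by exists a.
    have [bp|pb] /= := leP b p.2.
      by exists b'; split=> //; rewrite (lt_le_trans b'b bp) bp.
    exists (Num.max b' p.2); split.
    - by rewrite le_max ab'.
    - by rewrite gt_max b'b pb.
    - rewrite [b <= _]leNgt pb gt_max ltxx andbF /=.
      apply/allP => q qw; have /eqP := allP wb' q qw; rewrite gt_max.
      case: (leP b q.2) => [bq <-|bq <-] //=.
      by rewrite (lt_le_trans pb bq).
  by move=> [b' [? _ ?]]; exists b'.
by exists b'; split=> //; apply: eq_in_count => p ps; congr (_ && _);
  apply/eqP/bb'; rewrite mem_cat ps ?orbT.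
Qed.

End Truncation.

(** * Möbius inversion and rank inequalities *)

Section MobiusInversion.
Context d (T : finPOrderType d).

Lemma sum_mobius (x y : T) : (x <= y)%O ->
  \sum_(z | (x <= z <= y)%O) mobius x z = (x == y)%:R.
Proof.
rewrite le_eqVlt => /predU1P[<-|xy].
  rewrite eqxx (big_pred1 x) ?mobius_id // => z.
  by rewrite -eq_le eq_sym.
rewrite (bigD1 y) /=; last by rewrite (ltW xy) lexx.
rewrite lt_eqF // mobiusE // [X in _ + X](eq_bigl (fun z => x <= z < y)%O) ?addNr // => z.
by rewrite (lt_neqAle z) -andbA; congr (_ && _); rewrite andbC.
Qed.

(** It identifies a diagram from its sums over larger intervals, without computing
    the Möbius function. *)
Lemma mobius_inversion (h f : T -> int) :
  (forall x, h x = \sum_(y | (x <= y)%O) f y) -> mobius_conv h =1 f.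
Proof.
move=> hE x; rewrite /mobius_conv.
under eq_bigr do rewrite hE big_distrr /=.
rewrite (exchange_big_dep (fun y => x <= y)%O) /=; last first.
  by move=> y z; exact: le_trans.
under eq_bigr => y xy.
  rewrite -big_distrl /= sum_mobius //; over.
rewrite (bigD1 x) //= eqxx mul1r big1 ?addr0 // => y /andP[_ yx].
by rewrite eq_sym (negPf yx) mul0r.
Qed.

End MobiusInversion.

Section RankInequality.
Context (F : fieldType) d (P : porderType d) (M : pmodule F P).

(** The rank as a total function, without proofs of comparability. *)
Definition trank (i j : P) : nat :=
  if @idP (i <= j)%O is ReflectT h then rank M h else 0.

Lemma trankE (i j : P) (h : (i <= j)%O) : trank i j = rank M h.
Proof.
rewrite /trank; case: {-}_ / idP => [h'|//].
by congr rank; exact: bool_irrelevance.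
Qed.

(** Frobenius: composing with [j <= l] kills at least as much of the image of [i]
    as of the smaller image of [k]. *)
Lemma rank_frobenius (k i j l : P) (ki : (k <= i)%O) (ij : (i <= j)%O)
    (jl : (j <= l)%O) :
  (trank k j + trank i l <= trank i j + trank k l)%N.
Proof.
have kj := le_trans ki ij; have il := le_trans ij jl.
have kl := le_trans kj jl.
rewrite !trankE /rank (pm_hom_comp M ki ij kj) (pm_hom_comp M ij jl il).
rewrite (pm_hom_comp M kj jl kl) (pm_hom_comp M ki ij kj) !limg_comp.
set f := pm_hom M ij; set g := pm_hom M jl; set U := limg (pm_hom M ki).
have UV : (f @: U <= limg f)%VS by apply: limgS; exact: subvf.
have := limg_ker_dim g (f @: U); have := limg_ker_dim g (limg f).
have : (\dim (f @: U :&: lker g) <= \dim (limg f :&: lker g))%N.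
  by apply: dimvS; apply: capvS.
by lia.
Qed.

Lemma rank_monol (k i j : P) : (k <= i)%O -> (i <= j)%O ->
  (trank k j <= trank i j)%N.
Proof.
move=> ki ij; have kj := le_trans ki ij.
rewrite !trankE /rank (pm_hom_comp M ki ij kj) limg_comp.
by apply: dimvS; apply: limgS; exact: subvf.
Qed.

Lemma rank_monor (i j l : P) : (i <= j)%O -> (j <= l)%O ->
  (trank i l <= trank i j)%N.
Proof.
move=> ij jl; have il := le_trans ij jl.
rewrite !trankE /rank (pm_hom_comp M ij jl il) limg_comp.
by rewrite -(limg_ker_dim (pm_hom M jl) (limg (pm_hom M ij))) leq_addl.
Qed.

End RankInequality.

Lemma rank_iso F d (P : porderType d) (M N : pmodule F P) (a b : P)
  (h : (a <= b)%O) : pmodule_iso M N -> rank M h = rank N h.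
Proof.
move=> [phi [bij nat]]; rewrite /rank.
have kb : lker (phi b) == 0%VS.
  apply/lker0P; exact: bij_inj (bij b).
rewrite -(limg_dim_eq (f := phi b)); last first.
  by rewrite (eqP kb) capv0.
rewrite -limg_comp nat limg_comp; congr (\dim (_ @: _)).
apply/vspaceP => x; rewrite memvf; have [g _ gK] := bij a.
by rewrite -[x]gK memv_img // memvf.
Qed.

Section Multiplicity.
Context (F : fieldType) (m : nat) (M : pmodule F 'I_m.+1).

(** The rank of [[a - 1, b)], extended by 0 to [a = 0] and to [b = m + 2], so that
    the differences below need no case distinction at the border. *)
Definition srank (a b : nat) : nat :=
  if a is a'.+1 then
    if (b <= m.+1)%N then trank M (inord a') (inord b.-1) else 0
  else 0.

(** The number of summands equal to [[a, b)] in an interval decomposition, as a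
    mixed second difference of the ranks. *)
Definition multiplicity (a b : nat) : int :=
  (srank a.+1 b)%:Z - (srank a b)%:Z - (srank a.+1 b.+1)%:Z + (srank a b.+1)%:Z.

Lemma inord_le (i j : nat) : (i <= j)%N -> (j <= m)%N ->
  ((inord i : 'I_m.+1) <= inord j)%O.
Proof. by move=> ij jm; rewrite leEord /= !inordK ?ltnS // (leq_trans ij). Qed.

Lemma multiplicity_ge0 a b : (a < b <= m.+1)%N -> 0 <= multiplicity a b.
Proof.
case: b => [|b] //; rewrite !ltnS => /andP[ab bm].
rewrite /multiplicity /srank /= !ltnS bm.
have lab := inord_le ab bm.
have bl : b != m -> (b.+1 <= m)%N by move=> ?; rewrite ltn_neqAle bm andbT.
case: a ab lab => [|a] ab lab; rewrite ltn_neqAle bm;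
  case: eqVneq => [_|bm'] /=.
- by lia.
- by have := rank_monor M lab (inord_le (leqnSn b) (bl bm')); lia.
- by have := rank_monol M (inord_le (leqnSn a) (leq_trans ab bm)) lab; lia.
- by have := rank_frobenius M (inord_le (leqnSn a) (leq_trans ab bm)) lab
    (inord_le (leqnSn b) (bl bm')); lia.
Qed.

Lemma RankE (x : hoint 'I_m.+2) : Rank M x = srank (lo x).+1 (hi x).
Proof. by rewrite /srank -ltnS ltn_ord (trankE M (hoint_pred_le x)). Qed.

(** The sum telescopes in both coordinates. *)
Lemma sum_multiplicity (x : hoint 'I_m.+2) :
  \sum_(y | (x <= y)%O) multiplicity (lo y) (hi y) = (Rank M x)%:Z.
Proof.
transitivity (\sum_(a < m.+2 | (a <= lo x)%N)
    \sum_(b < m.+2 | (hi x <= b)%N) multiplicity a b).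
  rewrite pair_big /= [RHS](reindex_onto val (insubd x)) /=; last first.
    move=> [a b] /= /andP[ax xb]; rewrite /insubd insubT //=.
    rewrite ltEord /= (leq_ltn_trans ax) // (leq_trans _ xb) //.
    exact: (valP x).
  apply: eq_big => // y; rewrite valKd eqxx andbT.
  by rewrite -[LHS]/(hoint_sub x y) hoint_subE !leEord.
have srank_top a : srank a m.+2 = 0%N by case: a => //= a; rewrite ltnn.
under eq_bigr => a _.
  rewrite -(big_geq_mkord _ _ xpredT (multiplicity a)).
  rewrite (telescope_sumr_eq (fun b => (srank a b)%:Z - (srank a.+1 b)%:Z)).
  - by rewrite !srank_top subrr add0r opprB over.
  - exact/ltnW/ltn_ord.
  - by move=> b _; rewrite /multiplicity; lia.
rewrite RankE; pose f a := (srank a (hi x))%:Z.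
have lox : ((lo x).+1 <= m.+2)%N by exact: ltn_ord.
rewrite -(big_ord_widen_cond _ xpredT (fun a => f a.+1 - f a) lox).
by rewrite -(big_mkord xpredT (fun a => f a.+1 - f a)) telescope_sumr // subr0.
Qed.

End Multiplicity.

(** * Diagrams as multiplicities in lists *)

Lemma count_flatten_nseq (I T : Type) (P : pred T) (f : I -> nat) (g : I -> T)
    (w : seq I) :
  count P (flatten [seq nseq (f x) (g x) | x <- w]) =
  (\sum_(x <- w) P (g x) * f x)%N.
Proof.
elim: w => [|x w IH]; first by rewrite big_nil.
by rewrite /= count_cat IH count_nseq big_cons.
Qed.

Section Grid.
Context (R : realType) (m : nat) (iota : 'I_m.+2 -> R).
Hypotheses (iota_inj : injective iota)
  (iota_homo : {homo iota : i j / (i <= j)%O}).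
Implicit Types (u v s : seq (R * R)) (x y : hoint 'I_m.+2).

Definition gpt x : R * R := (iota (lo x), iota (hi x)).

(** Nothing is required on or below the diagonal, where a scan may leave the grid. *)
Definition on_grid u := {in u, forall p, offdiag p -> exists x, p = gpt x}.

Lemma iota_mono : {mono iota : i j / (i <= j)%O}.
Proof. by apply: le_mono; apply: inj_homo_lt. Qed.

Lemma iota_lt i j : (iota i < iota j)%O = (i < j)%O.
Proof. by rewrite !ltNge iota_mono. Qed.

Lemma gpt_offdiag x : offdiag (gpt x).
Proof. by rewrite /offdiag /= iota_lt; exact: (valP x). Qed.

Lemma gpt_inj : injective gpt.
Proof.
move=> [[a b] ?] [[a' b'] ?] []; rewrite /lo /hi /= => /iota_inj E1 /iota_inj E2.
by apply: val_inj; rewrite /= E1 E2.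
Qed.

Lemma gpt_le x y :
  ((gpt y).1 <= (gpt x).1) && ((gpt x).2 <= (gpt y).2) = (x <= y)%O.
Proof. by rewrite /= !iota_mono -[RHS]/(hoint_sub x y) hoint_subE. Qed.

Lemma cnt_grid u x : on_grid u -> (cnt u (gpt x).1 (gpt x).2)%:Z =
  \sum_(y | (x <= y)%O) (count_mem (gpt y) u)%:Z.
Proof.
elim: u => [|p u IH] gu; first by rewrite big1.
rewrite /cnt [count _ _]/= -!/(cnt _ _ _) PoszD IH => [|q qu]; last first.
  by apply: gu; rewrite inE qu orbT.
rewrite /= -[RHS]/(\sum_(y | (x <= y)%O) ((p == gpt y) + count_mem (gpt y) u)%N%:Z).
under [RHS]eq_bigr do rewrite PoszD.
rewrite big_split /=; congr (_ + _).
have [op|nop] := boolP (offdiag p); last first.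
  rewrite big1 => [|y _]; last first.
    by case: eqP nop => // -> /negP[]; exact: gpt_offdiag.
  case: andP nop => // -[p1 p2] /negP[].
  exact: le_lt_trans p1 (lt_le_trans (gpt_offdiag x) p2).
have [|y ->] := gu p _ op; first exact: mem_head.
rewrite gpt_le; under eq_bigr do rewrite (inj_eq gpt_inj).
have [xy|xy] := boolP (x <= y)%O.
  rewrite (bigD1 y) //= eqxx big1 ?addr0 // => z /andP[_].
  by rewrite eq_sym => /negPf ->.
by rewrite big1 // => z xz; case: eqP xy => // ->; rewrite xz.
Qed.

Lemma mobius_grid u v (h : hoint 'I_m.+2 -> int) : on_grid u -> on_grid v ->
  (forall x, h x = (cnt u (gpt x).1 (gpt x).2)%:Z - (cnt v (gpt x).1 (gpt x).2)%:Z) ->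
  forall x, mobius_conv h x =
    (count_mem (gpt x) u)%:Z - (count_mem (gpt x) v)%:Z.
Proof.
move=> gu gv hE; apply: mobius_inversion => x.
by rewrite hE !cnt_grid // sumrB.
Qed.

Lemma push_grid u v (f : hoint 'I_m.+2 -> int) : on_grid u -> on_grid v ->
  (forall x, f x = (count_mem (gpt x) u)%:Z - (count_mem (gpt x) v)%:Z) ->
  forall z, push_diagram iota f z =
    (count_mem (val z) u)%:Z - (count_mem (val z) v)%:Z.
Proof.
move=> gu gv fE z; rewrite /push_diagram; case: pickP => [w|none].
  by move=> /andP[/eqP l /eqP h]; rewrite fE /gpt l h -surjective_pairing.
have nz w : on_grid w -> count_mem (val z) w = 0%N.
  move=> gw; apply/count_memPn/negP => /gw /(_ (valP z))[x E].
  by have := none x; rewrite /lo /hi E !eqxx.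
by rewrite !nz.
Qed.

(** Such a list exists because the multiplicities are nonnegative. *)
Lemma Rank_list (F : fieldType) (M : pmodule F 'I_m.+1) :
  exists s, {in s, forall p, exists x, p = gpt x} /\
    forall x, Rank M x = cnt s (gpt x).1 (gpt x).2.
Proof.
pose f x := `|multiplicity M (lo x) (hi x)|%N.
exists (flatten [seq nseq (f x) (gpt x) | x <- index_enum (hoint 'I_m.+2)]); split.
  by move=> p /flatten_mapP[x _ /nseqP[-> _]]; exists x.
move=> x; rewrite /cnt count_flatten_nseq; apply/eqP; rewrite -eqz_nat.
rewrite -sum_multiplicity -natz raddf_sum /= [X in _ == X]big_mkcond.
rewrite [X in X == _]big_mkcond /=; apply/eqP/eq_bigr => y _.
rewrite gpt_le natz; case: (x <= y)%O => //; rewrite mul1n /f gez0_abs //.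
by apply: multiplicity_ge0; rewrite -[(hi y <= _)%N]ltnS ltn_ord andbT; exact: (valP y).
Qed.

End Grid.

(** * Diagrams in terms of the rank function *)

Lemma zext_hom_rank (F : fieldType) d (Q : porderType d) (M : pmodule F Q)
    (o1 o2 : option Q) (h : opt_le o1 o2) :
  \dim (limg (zext_hom M h)) =
  if o1 is Some i then if o2 is Some j then trank M i j else 0%N else 0%N.
Proof.
case: o1 o2 h => [i|] [j|] h /=; first by rewrite (trankE M (h i j erefl erefl)).
all: by rewrite lim0g dimv0.
Qed.

Lemma rank_bar (R : realType) (m : nat) (iota : 'I_m.+2 -> R) (F : fieldType)
    (M : pmodule F 'I_m.+1) (a b : R) (h : (a <= b)%O) :
  rank (bar iota M) h =
  if bar_idx iota a is Some i then
    if bar_idx iota b is Some j then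
      if (j <= m)%N then trank M (inord i) (inord j) else 0%N
    else 0%N
  else 0%N.
Proof.
rewrite /rank zext_hom_rank.
case Ea: (bar_idx iota a) => [i|] //; case Eb: (bar_idx iota b) => [j|] //.
have ij : (i <= j)%O by exact: bar_idx_homo h _ _ Ea Eb.
rewrite (trankE (hat M) ij) /rank zext_hom_rank /hat_idx.
case: (insubP _ (j : nat)) => [j' + Ej|]; last first.
  by rewrite ltnS => /negPf ->; case: insub.
rewrite ltnS => jm; rewrite jm insubT ?ltnS => [|im].
  by rewrite (leq_trans ij jm).
by congr trank; apply: val_inj; rewrite /= inordK // ?Ej.
Qed.

Section Presentation.
Context (R : realType) (F : fieldType).
Implicit Types (M : pmodule F R) (s u v : seq (R * R)).

Definition counts_rank M s :=
  forall a b (h : (a <= b)%O), rank M h = cnt_open s a b.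

Section Fixed.
Context (M : pmodule F R) (m : nat) (M' : pmodule F 'I_m.+1)
  (iota : 'I_m.+2 -> R) (pres : presented_by M M' iota).

Let iota_inj : injective iota. Proof. by case: pres. Qed.
Let iota_homo : {homo iota : i j / (i <= j)%O}. Proof. by case: pres. Qed.

(** Both sides depend only on the grid cells of [a] and [b]. *)
Lemma presented_counts s : on_grid iota s ->
    (forall x, Rank M' x = cnt s (gpt iota x).1 (gpt iota x).2) ->
  counts_rank M s.
Proof.
move=> gs sE a b ab; case: (pres) => _ _ /(rank_iso ab) ->; rewrite rank_bar.
have grid p : p \in s -> p.1 <= a -> b < p.2 -> exists x, p = gpt iota x.
  by move=> ps pa bp; apply: gs => //; apply: le_lt_trans pa (le_lt_trans ab bp).
have none : (forall x, iota (lo x) <= a -> b < iota (hi x) -> False) ->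
    0%N = cnt_open s a b.
  move=> no; apply/esym/eqP; rewrite -leqn0 leqNgt -has_count; apply/hasPn => p ps.
  by apply/andP=> -[pa bp]; have [x E] := grid p ps pa bp; subst p; exact: (no x).
case Ea: (bar_idx iota a) => [i|]; last first.
  by apply: none => x xa _; have := bar_idxN xa; rewrite Ea.
have [ia imax] := bar_idxE Ea.
case Eb: (bar_idx iota b) => [j|]; last first.
  by have := bar_idxN (le_trans ia ab); rewrite Eb.
have [jb jmax] := bar_idxE Eb.
have ij : (i <= j)%O by apply: jmax; exact: le_trans ab.
have bE l : (b < iota l) = (j < l)%O.
  rewrite !ltNge; congr (~~ _); apply/idP/idP; first exact: jmax.
  by move=> lj; apply: le_trans jb; exact: iota_homo.
case: leqP => [jm|mj]; last first.
  apply: none => x _; rewrite bE ltEord /= => jx.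
  by have := leq_trans jx (ltn_ord (hi x)); rewrite ltnNge mj.
have ij1 : (i < (inord j.+1 : 'I_m.+2))%O.
  by rewrite ltEord /= inordK // ltnS.
pose x : hoint 'I_m.+2 := exist _ (i, inord j.+1) ij1.
transitivity (Rank M' x).
  by rewrite /Rank -trankE /lo /hi /= inordK.
rewrite sE; apply: eq_in_count => p ps /=.
have [op|nop] := boolP (offdiag p); last first.
  transitivity false; [|symmetry]; apply: contraNF nop => /andP[p1 p2].
    exact: le_lt_trans p1 (lt_le_trans (gpt_offdiag iota_inj iota_homo x) p2).
  exact: le_lt_trans p1 (le_lt_trans ab p2).
have [y ->] := gs p ps op; rewrite /= bE -[lo x]/i -[hi x]/(inord j.+1); congr (_ && _).
  by apply/idP/idP => [yi|/imax /iota_homo//]; exact: le_trans ia.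
by rewrite (iota_mono iota_inj iota_homo) leEord ltEord /= inordK.
Qed.

(** Different presentations of a module give the same diagram: off the diagonal, a
    list that counts the ranks of the module is determined by these ranks. *)
Lemma counts_rank_list s : counts_rank M s ->
  exists s', [/\ {in s', forall p, exists x, p = gpt iota x},
    forall x, Rank M' x = cnt s' (gpt iota x).1 (gpt iota x).2 &
    forall a b, a < b -> cnt s' a b = cnt s a b].
Proof.
move=> Ms; have [s' [gs' s'E]] := Rank_list iota_inj iota_homo M'.
have Ms' : counts_rank M s' by apply: presented_counts s'E => p /gs'.
exists s'; split=> // a b ab.
have [b' [ab' -> ->]] := cnt_openE s' s ab.
by rewrite -(Ms' _ _ ab') -(Ms _ _ ab').
Qed.

Lemma PD_counts s : counts_rank M s ->
  forall z, push_diagram iota (PD M') z = (count_mem (val z) s)%:Z.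
Proof.
move=> /counts_rank_list[s' [gs' s'E ss]] z.
have gs : on_grid iota s' by move=> p /gs'.
rewrite (@push_grid _ _ _ s' [::]) //= ?subr0.
  by rewrite (cnt_inj ss (valP z)).
move=> x; apply: (@mobius_grid _ _ _ iota_inj iota_homo s' [::]) => // y.
by rewrite s'E /cnt /= subr0.
Qed.

(** [Rank_k] is the difference of the truncations of the rank at [k - 1] and at
    [k]. *)
Lemma PD_k_counts k s u v : (0 < k)%N -> counts_rank M s ->
    truncation k.-1 s u -> truncation k s v ->
  forall z, push_diagram iota (PD_k M' k) z =
    (count_mem (val z) u)%:Z - (count_mem (val z) v)%:Z.
Proof.
move=> k0 /counts_rank_list[s' [gs s'E ss]] su sv z.
have grid w : {in w, forall p, offdiag p -> p.1 \in unzip1 s' /\ p.2 \in unzip2 s'} ->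
    on_grid iota w.
  move=> ws p pw op; have [/mapP[q /gs[x ->] p1] /mapP[r /gs[y ->] p2]] := ws p pw op.
  have xy : (lo x < hi y)%O.
    by rewrite -(iota_lt iota_inj iota_homo); move: op; rewrite /offdiag p1 p2.
  by exists (exist _ (lo x, hi y) xy); rewrite [p]surjective_pairing p1 p2.
have [u' [su' /grid gu]] := truncation_grid k.-1 s'.
have [v' [sv' /grid gv]] := truncation_grid k s'.
have eq_uv w w' j : truncation j s w -> truncation j s' w' ->
    count_mem (val z) w' = count_mem (val z) w.
  by move=> sw sw'; apply: cnt_inj (valP z) => a b ab; rewrite sw' // sw // ss.
rewrite -(eq_uv _ _ _ su su') -(eq_uv _ _ _ sv sv'); move: z {eq_uv}.
apply: push_grid => // x; apply: mobius_grid => // y; rewrite /Rank_k s'E.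
rewrite su' ?sv' //; first last.
- exact: gpt_offdiag.
- exact: gpt_offdiag.
by case: leqP; lia.
Qed.


End Fixed.
End Presentation.

(** * Couplings and lists of pairs *)

Lemma count_mem_flatten_nseq (T : eqType) (f : T -> nat) (w : seq T) (x : T) :
  count_mem x (flatten [seq nseq (f y) y | y <- undup w]) =
  if x \in w then f x else 0%N.
Proof.
rewrite count_flatten_nseq -mem_undup; case: ifP => xw.
  rewrite (bigD1_seq x) ?undup_uniq //= eqxx mul1n big1 ?addn0 // => y.
  by case: eqVneq.
by rewrite big_seq big1 // => y yw /=; case: eqP => // E; rewrite -E yw in xw.
Qed.

Section FiniteSums.
Context (R : realType) (T : choiceType).

Lemma esum_count (l : seq T) (f : T -> R) : (forall x, 0 <= f x) ->
  \esum_(x in setT) ((count_mem x l)%:R * f x)%:E = (\sum_(x <- l) f x)%:E.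
Proof.
move=> f0; elim: l => [|y l IH].
  by rewrite big_nil; apply: esum1 => x _ /=; rewrite mul0r.
rewrite big_cons EFinD -IH.
transitivity (\esum_(x in setT) (((y == x)%:R * f x)%:E +
    ((count_mem x l)%:R * f x)%:E)%E).
  by apply: eq_esum => x _; rewrite -EFinD -mulrDl -natrD.
rewrite esumD; [|by move=> x _; rewrite lee_fin mulr_ge0..].
congr (_ + _)%E; rewrite -(@esum_set1 _ _ y (fun x => (f x)%:E)) ?lee_fin //.
rewrite [RHS]esum_mkcond; apply: eq_esum => x _; rewrite in_set1 eq_sym.
by case: eqP; rewrite ?mul1r ?mul0r.
Qed.

Lemma esum_count1 (l : seq T) :
  \esum_(x in setT) (count_mem x l)%:R%:E = (size l)%:R%:E :> \bar R.
Proof.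
rewrite -[in RHS]sum1_size natr_sum -(@esum_count l (fun=> 1)) //.
by apply: eq_esum => x _; rewrite mulr1.
Qed.

(** A list of [n + 1] distinct points of the support would make the sum exceed [n];
    so a list that cannot be extended exists. *)
Lemma esum_nat_support (n : nat) (f : T -> nat) :
  n%:R%:E = \esum_(x in setT) (f x)%:R%:E :> \bar R ->
  exists w : seq T, forall x, (0 < f x)%N -> x \in w.
Proof.
move=> nE; apply/not_existsP => no.
have [w [uw sw fw]] : exists w : seq T,
    [/\ uniq w, size w = n.+1 & {in w, forall x, (0 < f x)%N}].
  elim: n.+1 => [|k [w [uw sw fw]]]; first by exists [::].
  have /existsNP[x /not_implyP[fx /negP xw]] := no w.
  exists (x :: w); split; rewrite /= ?sw ?xw // => y.
  by rewrite inE => /orP[/eqP->//|/fw].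
have : ((size w)%:R%:E <= n%:R%:E :> \bar R)%E.
  rewrite nE -esum_count1; apply: le_esum => x _; rewrite lee_fin ler_nat.
  by rewrite count_uniq_mem //; have := fw x; case: (x \in w) => // ->.
by rewrite lee_fin ler_nat sw ltnn.
Qed.

End FiniteSums.

Section CouplingLists.
Context (R : realType).
Implicit Types (P Q : hoint R -> nat) (g : dpoint R -> dpoint R -> nat).
Implicit Types (l : seq (dpoint R * dpoint R)) (s t u v : seq (R * R)).

Definition list_coupling l (p q : dpoint R) : nat := count_mem (p, q) l.

Lemma esum_list_coupling_fst l p : \esum_(q in setT) (list_coupling l p q)%:R%:E =
  (count (fun e => e.1 == p) l)%:R%:E :> \bar R.
Proof.
rewrite -size_filter -(size_map snd) -esum_count1; apply: eq_esum => q _.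
rewrite count_map count_filter /list_coupling; congr (_%:R%:E).
by apply: eq_count => -[a b] /=; rewrite xpair_eqE andbC.
Qed.

Lemma esum_list_coupling_snd l q : \esum_(p in setT) (list_coupling l p q)%:R%:E =
  (count (fun e => e.2 == q) l)%:R%:E :> \bar R.
Proof.
rewrite -size_filter -(size_map fst) -esum_count1; apply: eq_esum => p _.
rewrite count_map count_filter /list_coupling; congr (_%:R%:E).
Qed.

Lemma dist1_ge0 (p q : dpoint R) : 0 <= dist1 p q.
Proof. exact: addr_ge0. Qed.

Lemma cost_list_coupling l : cost (list_coupling l) = (\sum_(e <- l) dist1 e.1 e.2)%:E.
Proof.
rewrite -(esum_count l (f := fun e => dist1 e.1 e.2)); last first.
  by move=> e; exact: dist1_ge0.
by apply: eq_esum => -[p q] _.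
Qed.

Lemma esum_nat_ge (T : choiceType) (f : T -> nat) (x : T) (n : nat) :
  n%:R%:E = \esum_(y in setT) (f y)%:R%:E :> \bar R -> (f x <= n)%N.
Proof.
move=> nE; rewrite -(ler_nat R) -lee_fin nE.
rewrite -(@esum_set1 _ _ x (fun y => (f y)%:R%:E)) ?lee_fin //.
rewrite [X in (X <= _)%E]esum_mkcond; apply: le_esum => y _.
by case: ifP; rewrite lee_fin.
Qed.

(** A coupling of finitely supported functions has finite support. *)
Lemma coupling_list P Q g (zP zQ : seq (hoint R)) :
    (forall z, (0 < P z)%N -> z \in zP) -> (forall z, (0 < Q z)%N -> z \in zQ) ->
  coupling P Q g -> exists l, g = list_coupling l.
Proof.
move=> hP hQ [g0 gP gQ].
have /boolp.choice[wP wPE] z := esum_nat_support (gP z).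
have /boolp.choice[wQ wQE] z := esum_nat_support (gQ z).
pose w := flatten [seq [seq (inl z, q) | q <- wP z] | z <- zP] ++
  flatten [seq [seq (p, inl z) | p <- wQ z] | z <- zQ] : seq (dpoint R * dpoint R).
exists (flatten [seq nseq (g e.1 e.2) e | e <- undup w]).
apply/funext => p; apply/funext => q.
rewrite /list_coupling (count_mem_flatten_nseq (fun e => g e.1 e.2)) /=; case: ifP => // pqw.
apply/eqP; rewrite -leqn0 leqNgt; apply/negP => gpq; move/negP: pqw; apply.
rewrite mem_cat; case: p q gpq => [z|x] [z'|x'] gpq.
- apply/orP; left; apply/flatten_mapP; exists z; last exact/map_f/wPE.
  by apply: hP; apply: leq_trans gpq (esum_nat_ge _ (gP z)).
- apply/orP; left; apply/flatten_mapP; exists z; last exact/map_f/wPE.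
  by apply: hP; apply: leq_trans gpq (esum_nat_ge _ (gP z)).
- apply/orP; right; apply/flatten_mapP; exists z'.
    by apply: hQ; apply: leq_trans gpq (esum_nat_ge (inr x) (gQ z')).
  by apply/mapP; exists (inr x) => //; exact: wQE.
- by rewrite g0 in gpq.
Qed.

Lemma coords_eq (p : dpoint R) (z : hoint R) : (coords p == val z) = (p == inl z).
Proof.
case: p => [z'|x] /=; first by rewrite -surjective_pairing.
apply/negP => /eqP E; have := valP z.
by rewrite -[\val z]E /= ltxx.
Qed.

Lemma dist1E (p q : dpoint R) : dist1 p q = l1dist (coords p) (coords q).
Proof. by []. Qed.

Lemma coupling_matched P Q l : coupling P Q (list_coupling l) ->
  exists s t, [/\ matched s t (\sum_(e <- l) dist1 e.1 e.2),
    forall z, P z = count_mem (val z) s & forall z, Q z = count_mem (val z) t].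
Proof.
move=> [_ hP hQ]; pose l' := [seq (coords e.1, coords e.2) | e <- l].
exists (unzip1 l'), (unzip2 l'); split.
- by exists l'; split=> //; rewrite /mcost big_map.
- move=> z; have [] := hP z; rewrite esum_list_coupling_fst => -[/eqP].
  rewrite eqr_nat => /eqP ->; rewrite /unzip1 -map_comp count_map.
  by apply: eq_count => e /=; rewrite coords_eq.
- move=> z; have [] := hQ z; rewrite esum_list_coupling_snd => -[/eqP].
  rewrite eqr_nat => /eqP ->; rewrite /unzip2 -map_comp count_map.
  by apply: eq_count => e /=; rewrite coords_eq.
Qed.

(** A point on or below the diagonal is replaced by a projection of its partner to
    the diagonal, which is at least as close to the partner. A pair of two such
    points is dropped. *)
Definition to_dpoints (e : (R * R) * (R * R)) : option (dpoint R * dpoint R) :=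
  match insub e.1 : option (hoint R), insub e.2 : option (hoint R) with
  | Some z, Some w => Some (inl z, inl w)
  | Some z, None => Some (inl z, inr e.1.1)
  | None, Some w => Some (inr e.2.1, inl w)
  | None, None => None
  end.

Lemma to_dpoints_cost e d :
  to_dpoints e = Some d -> dist1 d.1 d.2 <= l1dist e.1 e.2.
Proof.
case: e => [[x y] [x' y']]; rewrite /to_dpoints.
case: insubP => [z _ zE|]; case: insubP => [w _ wE|] //=.
- by move=> [<-]; rewrite dist1E /= /lo /hi zE wE.
- rewrite -leNgt => yx' [<-]; rewrite /dist1 /l1dist /= /lo /hi zE /=.
  have := valP z; rewrite zE /= => xy.
  rewrite subrr normr0 add0r distrC gtr0_norm ?subr_gt0 //.
  by have := ler_norm (x' - x); have := ler_norm (y - y'); rewrite (distrC y); lra.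
- rewrite -leNgt => yx [<-]; rewrite /dist1 /l1dist /= /lo /hi wE /=.
  have := valP w; rewrite wE /= => xy.
  rewrite subrr normr0 add0r gtr0_norm ?subr_gt0 //.
  by have := ler_norm (x - x'); have := ler_norm (y' - y); rewrite (distrC x); lra.
Qed.

Lemma count_to_dpoints_fst (l : seq ((R * R) * (R * R))) (z : hoint R) :
  count (fun e => e.1 == inl z) (pmap to_dpoints l) = count_mem (val z) (unzip1 l).
Proof.
elim: l => //= -[p q] l <-; rewrite /to_dpoints /=.
case: insubP => [z' _ <-|pn]; last first.
  have -> : (p == val z) = false by apply: contraNF pn => /eqP ->; exact: (valP z).
  by case: insub.
by rewrite (inj_eq val_inj); case: insub.
Qed.

Lemma count_to_dpoints_snd (l : seq ((R * R) * (R * R))) (z : hoint R) :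
  count (fun e => e.2 == inl z) (pmap to_dpoints l) = count_mem (val z) (unzip2 l).
Proof.
elim: l => //= -[p q] l <-; rewrite /to_dpoints /=.
case: (insubP _ q) => [z' _ <-|pn]; last first.
  have -> : (q == val z) = false by apply: contraNF pn => /eqP ->; exact: (valP z).
  by case: insub.
by rewrite (inj_eq val_inj); case: insub.
Qed.

Lemma matched_W11 P Q s t c : matched s t c ->
  (forall z, P z = count_mem (val z) s) -> (forall z, Q z = count_mem (val z) t) ->
  (W11_nat P Q <= c%:E)%E.
Proof.
move=> [l [ls lt lc]] hP hQ; pose l' := pmap to_dpoints l.
have lE : (cost (list_coupling l') <= c%:E)%E.
  rewrite cost_list_coupling lee_fin; apply: le_trans lc; rewrite /mcost /l'.
  elim: l {ls lt l'} => [|e l IH]; first by rewrite !big_nil.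
  rewrite /= big_cons; case E: (to_dpoints e) => [d|] /=.
    by rewrite big_cons lerD // to_dpoints_cost.
  by rewrite -[X in X <= _]add0r lerD // addr_ge0.
apply: le_trans lE; apply: ereal_inf_lbound; exists (list_coupling l') => //; split.
- move=> x y; apply/count_memPn; rewrite mem_pmap; apply/mapP => -[[p q] _].
  by rewrite /to_dpoints; case: insub => [?|]; case: insub.
- by move=> z; rewrite esum_list_coupling_fst count_to_dpoints_fst hP (permP ls).
- by move=> z; rewrite esum_list_coupling_snd count_to_dpoints_snd hQ (permP lt).
Qed.

(** The lists [u ++ v'] and [u' ++ v] exceed the two sides of the signed distance by
    the same list: the points that cancel in [u - v] and in [u' - v']. *)
Lemma matched_W11_signed (A B : hoint R -> int) u v u' v' c :
  matched (u ++ v') (u' ++ v) c ->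
  (forall z, A z = (count_mem (val z) u)%:Z - (count_mem (val z) v)%:Z) ->
  (forall z, B z = (count_mem (val z) u')%:Z - (count_mem (val z) v')%:Z) ->
  (W11 A B <= c%:E)%E.
Proof.
set w1 := u ++ v'; set w2 := u' ++ v => m hA hB.
pose P z := (pos_part A z + neg_part B z)%N.
pose Q z := (pos_part B z + neg_part A z)%N.
pose f1 p := if insub p is Some z then P z else count_mem p w1.
pose f2 p := if insub p is Some z then Q z else count_mem p w2.
pose mk (f : R * R -> nat) w := flatten [seq nseq (f p) p | p <- undup w].
pose r p := (count_mem p w1 - f1 p)%N.
have H p : (f1 p <= count_mem p w1)%N /\ count_mem p w2 = (r p + f2 p)%N.
  rewrite /r /f1 /f2; case: insubP => [z _ zp|_]; last by rewrite subnn leqnn.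
  rewrite /P /Q /pos_part /neg_part hA hB /w1 /w2 !count_cat -zp.
  by split; lia.
have mkE f w p : (forall q, f q <= count_mem q w)%N -> count_mem p (mk f w) = f p.
  move=> fw; rewrite count_mem_flatten_nseq; case: ifP => // /negbT pw.
  by have := fw p; rewrite (count_memPn pw); case: (f p).
have f1w q : (f1 q <= count_mem q w1)%N by case: (H q).
have f2w q : (f2 q <= count_mem q w2)%N by case: (H q) => _ ->; exact: leq_addl.
have rw q : (r q <= count_mem q w1)%N by exact: leq_subr.
have Ew1 : perm_eq w1 (mk r w1 ++ mk f1 w1).
  by apply/allP => p _ /=; rewrite count_cat !mkE // subnK.
have Ew2 : perm_eq w2 (mk r w1 ++ mk f2 w2).
  by apply/allP => p _ /=; rewrite count_cat !mkE //; case: (H p) => _ ->.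
have /matched_cancel := matched_perm Ew1 Ew2 m.
move=> /matched_W11; apply=> z.
- by rewrite mkE // /f1 valK.
- by rewrite mkE // /f2 valK.
Qed.

End CouplingLists.

(** * Stability *)

Section Bounds.
Context (R : realType) (F : fieldType).
Implicit Types (M N : pmodule F R) (s t u v : seq (R * R)).

Lemma tame_counts M : tame M -> exists s, counts_rank M s.
Proof.
move=> [m [M' [iota pres]]]; have [inj homo _] := pres.
have [s [gs sE]] := Rank_list inj homo M'.
by exists s; apply: (presented_counts pres) sE => p /gs.
Qed.

Lemma diagram_counts M D s : persistence_diagram M D -> counts_rank M s ->
  forall z, D z = (count_mem (val z) s)%:Z.
Proof.
by move=> [m [M' [iota [pres DE]]]] Ms z; rewrite DE (PD_counts pres Ms).
Qed.

Lemma graded_diagram_counts M k Dk s u v : (0 < k)%N ->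
    graded_persistence_diagram M k Dk -> counts_rank M s ->
    truncation k.-1 s u -> truncation k s v ->
  forall z, Dk z = (count_mem (val z) u)%:Z - (count_mem (val z) v)%:Z.
Proof.
move=> k0 [m [M' [iota [pres DE]]]] Ms su sv z.
by rewrite DE (PD_k_counts pres k0 Ms su sv).
Qed.

Lemma cnt_le_rank M s K : counts_rank M s ->
    (forall a b (h : (a <= b)%O), (rank M h <= K)%N) ->
  forall a b, a < b -> (cnt s a b <= K)%N.
Proof.
move=> Ms MK a b ab; have [b' [ab' -> _]] := cnt_openE s s ab.
by rewrite -(Ms _ _ ab').
Qed.

Lemma truncation_null k s u : truncation k s u ->
    (forall a b, a < b -> (cnt s a b <= k)%N) ->
  forall z : hoint R, count_mem (val z) u = 0%N.
Proof.
move=> su sk z; have zlt := valP z; apply/eqP; rewrite -leqn0.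
apply: (@leq_trans (cnt u (val z).1 (val z).2)).
  by apply: sub_count => p /eqP ->; rewrite !lexx.
by rewrite su // leqn0 subn_eq0 sk.
Qed.

Lemma truncation_eqr k s s' u : (forall a b, a < b -> cnt s' a b = cnt s a b) ->
  truncation k s' u -> truncation k s u.
Proof. by move=> ss su a b ab; rewrite su // ss. Qed.

(** A lower bound for all finite matchings of lists that carry the given diagrams
    off the diagonal is a lower bound for all couplings. *)
Lemma W11_ge (D E : hoint R -> int) s t (x : \bar R) :
    (forall z, D z = (count_mem (val z) s)%:Z) ->
    (forall z, E z = (count_mem (val z) t)%:Z) ->
    (forall s' t' c, (forall a b, a < b -> cnt s' a b = cnt s a b) ->
      (forall a b, a < b -> cnt t' a b = cnt t a b) ->
      matched s' t' c -> (x <= c%:E)%E) ->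
  (x <= W11 D E)%E.
Proof.
move=> DE EE hx; apply: le_ereal_inf_tmp => _ [g gc <-].
have {}gc : coupling (fun z => count_mem (val z) s) (fun z => count_mem (val z) t) g.
  move: gc; congr coupling; apply/funext => z;
    by rewrite /pos_part /neg_part DE EE; lia.
have sup w (z : hoint R) : (0 < count_mem (val z) w)%N ->
    z \in (pmap insub w : seq (hoint R)).
  by rewrite -has_count has_pred1 mem_pmap => zw; apply/mapP; exists (val z); rewrite ?valK.
have [l gE] := coupling_list (sup s) (sup t) gc; subst g.
have [s' [t' [m ss tt]]] := coupling_matched gc.
rewrite cost_list_coupling; apply: hx m => a b ab; apply: eq_count_mem => p /andP[pa bp].
- have op : p.1 < p.2 by exact: le_lt_trans pa (lt_le_trans ab bp).
  by have := ss (exist _ p op).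
- have op : p.1 < p.2 by exact: le_lt_trans pa (lt_le_trans ab bp).
  by have := tt (exist _ p op).
Qed.

Context (M N : pmodule F R) (D E : hoint R -> int)
  (Dk Ek : nat -> hoint R -> int) (K : nat).
Hypotheses (tM : tame M) (tN : tame N) (MD : persistence_diagram M D)
  (NE : persistence_diagram N E)
  (MDk : forall k, (1 <= k)%N -> graded_persistence_diagram M k (Dk k))
  (NEk : forall k, (1 <= k)%N -> graded_persistence_diagram N k (Ek k)).

Lemma graded_stability k : (1 <= k)%N ->
  (W11 (Dk k) (Ek k) <= 2%:E * W11 D E)%E.
Proof.
move=> k0; have [s Ms] := tame_counts tM; have [t Nt] := tame_counts tN.
rewrite -lee_pdivrMl //.
apply: (W11_ge (diagram_counts MD Ms) (diagram_counts NE Nt)) => s' t' c ss tt m.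
rewrite lee_pdivrMl // -EFinM mulr_natl mulr2n.
have [u [u' [mu su tu]]] := truncation_matched k.-1 m.
have [v [v' [mv sv tv]]] := truncation_matched k m.
apply: matched_W11_signed (matched_cat mu (matched_sym mv)) _ _.
- exact: graded_diagram_counts k0 (MDk k0) Ms (truncation_eqr ss su) (truncation_eqr ss sv).
- exact: graded_diagram_counts k0 (NEk k0) Nt (truncation_eqr tt tu) (truncation_eqr tt tv).
Qed.

Hypotheses (MK : forall a b (h : (a <= b)%O), (rank M h <= K)%N)
  (NK : forall a b (h : (a <= b)%O), (rank N h <= K)%N).

(** The truncations at [K] are null, so the second of the two estimates of
    [graded_stability] drops out. *)
Lemma top_graded_stability : (1 <= K)%N -> (W11 (Dk K) (Ek K) <= W11 D E)%E.
Proof.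
move=> K0; have [s Ms] := tame_counts tM; have [t Nt] := tame_counts tN.
apply: (W11_ge (diagram_counts MD Ms) (diagram_counts NE Nt)) => s' t' c ss tt m.
have [u [u' [mu su tu]]] := truncation_matched K.-1 m.
have [v [v' [_ sv tv]]] := truncation_matched K m.
apply: (@matched_W11_signed _ _ _ u [::] u' [::]); rewrite ?cats0 //.
- move=> z; rewrite (graded_diagram_counts K0 (MDk K0) Ms (truncation_eqr ss su)
    (truncation_eqr ss sv)).
  by rewrite (truncation_null (truncation_eqr ss sv) (cnt_le_rank Ms MK)).
- move=> z; rewrite (graded_diagram_counts K0 (NEk K0) Nt (truncation_eqr tt tu)
    (truncation_eqr tt tv)).
  by rewrite (truncation_null (truncation_eqr tt tv) (cnt_le_rank Nt NK)).
Qed.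

End Bounds.

Lemma graded_diagram0 (R : realType) (F : fieldType) (M : pmodule F R) K k Dk :
    tame M -> (K < k)%N -> (forall a b (h : (a <= b)%O), (rank M h <= K)%N) ->
  graded_persistence_diagram M k Dk -> forall z, Dk z = 0.
Proof.
move=> tM Kk MK MDk z; have [s Ms] := tame_counts tM.
have [u [su _]] := truncation_grid k.-1 s; have [v [sv _]] := truncation_grid k s.
have k0 := leq_ltn_trans (leq0n K) Kk.
have null j w : (K <= j)%N -> truncation j s w -> count_mem (val z) w = 0%N.
  move=> Kj sw; apply: (truncation_null sw) => a b ab.
  exact: leq_trans (cnt_le_rank Ms MK ab) Kj.
rewrite (graded_diagram_counts k0 MDk Ms su sv) (null _ _ _ su) ?(null _ _ _ sv) //.
- exact: ltnW.
- by rewrite -ltnS prednK.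
Qed.

(** * Sharpness *)

(** A coupling has to move each of the points [zs], which are at distance at least
    [c] from every point of the other side and from the diagonal. *)
Lemma W11_lower (R : realType) (A B : hoint R -> int) (u v u' v' : seq (R * R))
    (zs : seq (hoint R)) (c : R) : 0 <= c ->
    (forall z, A z = (count_mem (val z) u)%:Z - (count_mem (val z) v)%:Z) ->
    (forall z, B z = (count_mem (val z) u')%:Z - (count_mem (val z) v')%:Z) ->
    uniq zs ->
    {in zs, forall z, [/\ (val z \in u) && (val z \notin v) ||
          (val z \in v') && (val z \notin u'), c <= hi z - lo z
      & {in u' ++ v, forall q, c <= l1dist (val z) q}]} ->
  (((size zs)%:R * c)%:E <= W11 A B)%E.
Proof.
move=> c0 AE BE uz hz; apply: le_ereal_inf_tmp => _ [g gc <-].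
have sup w (z : hoint R) : val z \in w -> z \in (pmap insub w : seq (hoint R)).
  by rewrite mem_pmap => zw; apply/mapP; exists (val z); rewrite ?valK.
have Qsup z : (0 < pos_part B z + neg_part A z)%N -> val z \in u' ++ v.
  apply: contraTT; rewrite mem_cat => /norP[/count_memPn zu /count_memPn zv].
  by rewrite /pos_part /neg_part AE BE zu zv; lia.
have Psup z : (0 < pos_part A z + neg_part B z)%N -> val z \in u ++ v'.
  apply: contraTT; rewrite mem_cat => /norP[/count_memPn zu /count_memPn zv].
  by rewrite /pos_part /neg_part AE BE zu zv; lia.
have [l gE] := coupling_list (fun z zP => sup _ z (Psup z zP))
  (fun z zQ => sup _ z (Qsup z zQ)) gc.
subst g; case: gc => _ hP hQ; rewrite cost_list_coupling lee_fin.
apply: (@le_trans _ _ (\sum_(e <- l) \sum_(z <- zs) (e.1 == inl z)%:R * c)).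
  rewrite exchange_big /= -sum1_size natr_sum mulr_suml big_seq [leRHS]big_seq.
  apply: ler_sum => z zs_z; rewrite -mulr_suml ler_wpM2r // -natr_sum ler_nat.
  have [Az _ _] := hz z zs_z; have [] := hP z; rewrite esum_list_coupling_fst => -[/eqP].
  rewrite eqr_nat -sum1_count big_mkcond /= => /eqP PE.
  rewrite (eq_bigr (fun e : dpoint R * dpoint R => if e.1 == inl z then 1 else 0)%N);
    last by move=> e _; case: eqP.
  rewrite -PE; move: Az; rewrite /pos_part /neg_part AE BE -!has_pred1 !has_count.
  move: (count_mem _ u) (count_mem _ v) (count_mem _ u') (count_mem _ v').
  by move=> x y x' y'; clear; lia.
rewrite big_seq [leRHS]big_seq; apply: ler_sum => -[p q] pq /=.
have [/hasP[z zz /eqP pz]|] := boolP (has (fun z => p == inl z) zs); last first.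
  move=> /hasPn no; rewrite big_seq big1 ?dist1_ge0 // => z /no /negPf ->.
  by rewrite mul0r.
rewrite (bigD1_seq z) //= pz eqxx mul1r big1 ?addr0 => [|z' z'z]; last first.
  by rewrite -[_ == _]/(z == z') eq_sym (negPf z'z) mul0r.
have [_ hl hq] := hz z zz; case: q pq => [w|x] pq.
  apply: (hq (val w)); apply: Qsup.
  apply: leq_trans (esum_nat_ge (inl z) (hQ w)).
  by rewrite -has_count has_pred1 -pz.
rewrite /dist1 /=; apply: le_trans hl _.
have := ler_norm (x - lo z); have := ler_norm (hi z - x).
by rewrite (distrC (hi z)); lra.
Qed.

Section StaircaseModule.
Context (F : fieldType).

(** The module has two basis vectors, numbered 0 and 1; at [i] the vectors numbered
    from [soff i] on are alive, [sdim i] of them. *)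
Definition sdim (i : 'I_3) : nat := (i == 1 :> nat).+1.
Definition soff (i : 'I_3) : nat := (i == 2 :> nat).

Definition smx (i j : 'I_3) : 'M[F]_(sdim i, sdim j) :=
  \matrix_(r, c) (soff i + r == soff j + c)%N%:R.

Lemma smx_id i : smx i i = 1%:M.
Proof. by apply/matrixP => r c; rewrite !mxE eqn_add2l. Qed.

(** The composition law holds as soon as a basis vector alive at [i] and at [k] is
    alive at [j]; [j] need not lie between the two. *)
Lemma smx_comp (i j k : 'I_3) :
    (forall x, soff i <= x < soff i + sdim i -> soff k <= x < soff k + sdim k ->
      soff j <= x < soff j + sdim j)%N ->
  smx i j *m smx j k = smx i k.
Proof.
move=> ijk; apply/matrixP => r l; rewrite !mxE.
under eq_bigr do rewrite !mxE -natrM mulnb.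
have [E|ne] := eqVneq (soff i + r)%N (soff k + l)%N; last first.
  rewrite big1 // => c _; case: andP => // -[/eqP E1 /eqP E2].
  by rewrite E1 E2 eqxx in ne.
have := ijk (soff i + r)%N; have := ltn_ord r; have := ltn_ord l => rl rr.
case/(_ _ _)/andP; [lia|lia|] => x1 x2.
have cP : (soff i + r - soff j < sdim j)%N by lia.
rewrite (bigD1 (Ordinal cP)) //= -E subnKC // eqxx big1 ?addr0 // => c.
rewrite -val_eqE /= => cn; case: andP => // -[/eqP E1 _].
by move: cn; rewrite E1 addKn eqxx.
Qed.

Definition shom (i j : 'I_3) : 'Hom('rV[F]_(sdim i), 'rV[F]_(sdim j)) :=
  linfun (mulmxr (smx i j)).

Lemma shomE i j v : shom i j v = v *m smx i j.
Proof. by rewrite lfunE. Qed.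

Lemma shom_id i : shom i i = \1%VF.
Proof. by apply/lfunP => v; rewrite shomE smx_id mulmx1 lfunE. Qed.

Lemma shom_comp (i j k : 'I_3) : (i <= j)%O -> (j <= k)%O ->
  shom i k = (shom j k \o shom i j)%VF.
Proof.
rewrite !leEord => ij jk; apply/lfunP => v.
rewrite comp_lfunE !shomE -mulmxA smx_comp // => x.
by have := ltn_ord k; rewrite /soff /sdim; lia.
Qed.

(** The direct sum of the interval modules of [{0, 1}] and [{1, 2}]. *)
Definition staircase : pmodule F 'I_3 :=
  @PModule F _ 'I_3 (fun i => 'rV[F]_(sdim i)) (fun i j _ => shom i j)
    (fun i _ => shom_id i) (fun i j k ij jk _ => shom_comp ij jk).

Lemma rowspace_dim n : \dim (fullv : {vspace 'rV[F]_n}) = n.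
Proof. by rewrite dimvf /dim /= mul1n. Qed.

(** Between neighbours, the matrix of the opposite direction is a one-sided
    inverse. *)
Lemma trank_staircase (i j : 'I_3) : (i <= j)%O ->
  trank staircase i j = if i == j then sdim i else (j <= i.+1)%N.
Proof.
move=> ij; rewrite (trankE staircase ij) /rank /=.
have [<-|nij] := eqVneq i j; first by rewrite shom_id lim1g rowspace_dim.
have {nij}ij : (i < j)%N by move: ij nij; rewrite leEord -val_eqE /=; lia.
have j3 := ltn_ord j; have [ij1|ij1] /= := leqP j i.+1; last first.
  suff -> : shom i j = 0 by rewrite lim0g dimv0.
  apply/lfunP => v; rewrite shomE lfunE /= (_ : smx i j = 0) ?mulmx0 //.
  apply/matrixP => r c; rewrite !mxE.
  have : (r < (i == 1 :> nat).+1)%N := ltn_ord r.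
  rewrite /soff; move: (r : nat) (c : nat) => {}r {}c rlt.
  by rewrite (_ : (_ == _)%N = false) //; lia.
have [i0|i1] : (i = 0 :> nat \/ i = 1 :> nat) by lia.
- have K : smx i j *m smx j i = 1%:M.
    by rewrite smx_comp ?smx_id // => x; rewrite /soff /sdim; lia.
  rewrite limg_dim_eq ?rowspace_dim /sdim ?i0 //.
  rewrite capfv; apply/eqP/lker0P => v w.
  by rewrite !shomE => /(congr1 (mulmx^~ (smx j i))); rewrite -!mulmxA K !mulmx1.
- have K : smx j i *m smx i j = 1%:M.
    by rewrite smx_comp ?smx_id // => x; rewrite /soff /sdim; lia.
  transitivity (sdim j); last by rewrite /sdim; lia.
  rewrite -[RHS]rowspace_dim; congr (\dim _); apply/vspaceP => v.
  by rewrite memvf -[v]mulmx1 -K mulmxA -shomE memv_img ?memvf.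
Qed.

Section StaircaseRanks.
Context (R : realType) (iota : 'I_4 -> R).
Hypotheses (iota_inj : injective iota)
  (iota_homo : {homo iota : i j / (i <= j)%O}).

Let mono := iota_mono iota_inj iota_homo.

Definition sgens : seq (R * R) :=
  [:: (iota (inord 0), iota (inord 2)); (iota (inord 1), iota (inord 3))].

Lemma Rank_staircase (x : hoint 'I_4) :
  Rank staircase x = cnt sgens (gpt iota x).1 (gpt iota x).2.
Proof.
rewrite /Rank -trankE trank_staircase ?hoint_pred_le // /cnt /= addn0 !mono.
have h4 := ltn_ord (hi x); have lh : (lo x < hi x)%N := valP x.
rewrite !leEord -val_eqE /= /sdim !inordK //; last 2 first.
- by lia.
- by lia.
by move: (nat_of_ord (lo x)) (nat_of_ord (hi x)) h4 lh => a b; case: eqP; lia.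
Qed.

Lemma sgens_grid : {in sgens, forall p, exists x, p = gpt iota x}.
Proof.
have l02 : ((inord 0 : 'I_4) < inord 2)%O by rewrite ltEord /= !inordK.
have l13 : ((inord 1 : 'I_4) < inord 3)%O by rewrite ltEord /= !inordK.
move=> p; rewrite !inE => /orP[] /eqP ->.
  by exists (exist _ (inord 0, inord 2) l02).
by exists (exist _ (inord 1, inord 3) l13).
Qed.

Lemma bar_staircase_presented : presented_by (bar iota staircase) staircase iota.
Proof.
split=> //; exists (fun=> \1%VF); split=> [a|a b h].
  by exists id => v; rewrite lfunE.
by rewrite comp_lfun1l comp_lfun1r.
Qed.

Lemma bar_staircase_counts : counts_rank (bar iota staircase) sgens.
Proof.
apply: (presented_counts bar_staircase_presented) Rank_staircase => p ps _.
exact: sgens_grid.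
Qed.

End StaircaseRanks.

End StaircaseModule.

Section TwoBars.
Context (R : realType) (F : fieldType) (a b c d : R).
Hypothesis abcd : sorted <%R [:: a; b; c; d].

Definition grid4 (i : 'I_4) : R := nth 0 [:: a; b; c; d] i.

Lemma grid4_le : {mono grid4 : i j / (i <= j)%O >-> i <= j}.
Proof. by move=> i j; rewrite /grid4 lt_sorted_leq_nth ?inE. Qed.

Lemma grid4_homo : {homo grid4 : i j / (i <= j)%O >-> i <= j}.
Proof. by move=> i j; rewrite grid4_le. Qed.

Lemma grid4_inj : injective grid4.
Proof. exact: (inc_inj grid4_le). Qed.

Definition two_bars : pmodule F R := bar grid4 (staircase F).

Lemma two_bars_presented : presented_by two_bars (staircase F) grid4.
Proof. exact: bar_staircase_presented grid4_inj grid4_homo. Qed.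

Lemma two_bars_counts : counts_rank two_bars [:: (a, c); (b, d)].
Proof.
have := bar_staircase_counts F grid4_inj grid4_homo.
by rewrite /sgens /grid4 !inordK.
Qed.

Lemma two_bars_truncation1 : truncation 1 [:: (a, c); (b, d)] [:: (b, c)].
Proof.
move: abcd => /= /and4P[ab bc cd _] x y _; rewrite /cnt /=.
have [bx|xb] := leP b x; have [yc|cy] := leP y c; rewrite ?andbF /=.
- by rewrite (le_trans (ltW ab) bx) (le_trans yc (ltW cd)).
- by case: (a <= x); case: (y <= d).
- by case: (a <= x).
- by case: (a <= x).
Qed.

Lemma two_bars_truncation2 : truncation 2 [:: (a, c); (b, d)] [::].
Proof. by move=> x y _; rewrite /cnt /=; case: (_ && _); case: (_ && _). Qed.

Lemma two_bars_rank_le x y (h : (x <= y)%O) : (rank two_bars h <= 2)%N.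
Proof. by rewrite two_bars_counts; exact: count_size. Qed.

Lemma two_bars_rank_b : rank two_bars (lexx b) = 2.
Proof.
rewrite two_bars_counts /cnt_open /= lexx.
by move: abcd => /= /and4P[ab bc cd _]; rewrite (ltW ab) bc (lt_trans bc cd).
Qed.

Definition two_bars_diagram : hoint R -> int :=
  push_diagram grid4 (PD (staircase F)).

Definition two_bars_graded (k : nat) : hoint R -> int :=
  push_diagram grid4 (PD_k (staircase F) k).

Lemma two_bars_tame : tame two_bars.
Proof. by do 3 eexists; exact: two_bars_presented. Qed.

Lemma two_bars_diagramP : persistence_diagram two_bars two_bars_diagram.
Proof. by do 3 eexists; split; first exact: two_bars_presented. Qed.

Lemma two_bars_gradedP k :
  graded_persistence_diagram two_bars k (two_bars_graded k).
Proof. by do 3 eexists; split; first exact: two_bars_presented. Qed.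

Lemma two_bars_diagramE z :
  two_bars_diagram z = (count_mem (val z) [:: (a, c); (b, d)])%:Z.
Proof. exact: diagram_counts two_bars_diagramP two_bars_counts z. Qed.

Lemma two_bars_graded1E z : two_bars_graded 1 z =
  (count_mem (val z) [:: (a, c); (b, d)])%:Z - (count_mem (val z) [:: (b, c)])%:Z.
Proof.
apply: graded_diagram_counts (two_bars_gradedP 1) two_bars_counts _ _ z => //.
  by move=> x y _; rewrite subn0.
exact: two_bars_truncation1.
Qed.

Lemma two_bars_graded2E z : two_bars_graded 2 z =
  (count_mem (val z) [:: (b, c)])%:Z - (count_mem (val z) [::])%:Z.
Proof.
apply: graded_diagram_counts (two_bars_gradedP 2) two_bars_counts _ _ z => //.
  exact: two_bars_truncation1.
exact: two_bars_truncation2.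
Qed.

End TwoBars.

Section Sharpness.
Context (R : realType) (F : fieldType).

Let g1 : sorted <%R [:: 0; 1; 3; 5 : R]. Proof. by rewrite /=; lra. Qed.
Let g2 : sorted <%R [:: 0; 2; 3; 5 : R]. Proof. by rewrite /=; lra. Qed.

Let D := two_bars_diagram F (0 : R) 1 3 5.
Let E := two_bars_diagram F (0 : R) 2 3 5.
Let Dk := two_bars_graded F (0 : R) 1 3 5.
Let Ek := two_bars_graded F (0 : R) 2 3 5.

Let DE : forall z, D z = (count_mem (val z) [:: (0, 3); (1, 5)])%:Z -
  (count_mem (val z) [::])%:Z.
Proof. by move=> z; rewrite subr0; exact: two_bars_diagramE. Qed.

Let EE : forall z, E z = (count_mem (val z) [:: (0, 3); (2, 5)])%:Z -
  (count_mem (val z) [::])%:Z.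
Proof. by move=> z; rewrite subr0; exact: two_bars_diagramE. Qed.

Lemma l1dist_ge (p q : R * R) (c : R) :
  [|| c <= q.1 - p.1, c <= p.1 - q.1, c <= q.2 - p.2 | c <= p.2 - q.2] ->
  c <= l1dist p q.
Proof.
rewrite /l1dist; case: p q => [x y] [x' y'] /=.
have := ler_norm (x' - x); have := ler_norm (x - x'); rewrite (distrC x).
have := ler_norm (y' - y); have := ler_norm (y - y'); rewrite (distrC y).
have := normr_ge0 (x' - x); have := normr_ge0 (y' - y).
by move=> ? ? ? ? ? ? /or4P[] ?; lra.
Qed.

Lemma W11_sharp_le1 : (W11 D E <= 1%:E)%E.
Proof.
apply: (matched_W11_signed _ DE EE); exists [:: ((0, 3), (0, 3)); ((1, 5), (2, 5))].
split=> //; rewrite /mcost !big_cons big_nil /l1dist /= !subrr normr0 !add0r !addr0.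
by rewrite ger0_norm; lra.
Qed.

Let lt15 : ((1 : R) < 5)%O. Proof. by lra. Qed.
Let lt23 : ((2 : R) < 3)%O. Proof. by lra. Qed.
Let lt13 : ((1 : R) < 3)%O. Proof. by lra. Qed.

Lemma W11_sharp_ge1 : (1%:E <= W11 (Dk 2) (Ek 2))%E.
Proof.
have := @W11_lower _ _ _ _ _ _ _ [:: exist _ (1, 3) lt13] 1 ler01
  (two_bars_graded2E F g1) (two_bars_graded2E F g2) isT.
rewrite mulr1; apply=> z; rewrite inE => /eqP ->; split.
- by rewrite /= inE eqxx.
- by rewrite /lo /hi /=; lra.
- by move=> q; rewrite inE => /eqP ->; apply: l1dist_ge => /=; lra.
Qed.

(** The points (1, 5) and, from the negative part of the other diagram, (2, 3) must
    both move by at least 1. *)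
Lemma W11_sharp_ge2 : (2%:E <= W11 (Dk 1) (Ek 1))%E.
Proof.
have := @W11_lower _ _ _ _ _ _ _ [:: exist _ (1, 5) lt15; exist _ (2, 3) lt23] 1
  ler01 (two_bars_graded1E F g1) (two_bars_graded1E F g2).
rewrite mulr1; apply.
  rewrite /= inE andbT -val_eqE /=; apply/eqP => -[]; lra.
move=> z; rewrite !inE => /orP[] /eqP ->; split.
- apply/orP; left; rewrite /= eqxx orbT /=; apply/eqP => -[]; lra.
- by rewrite /lo /hi /=; lra.
- move=> q; rewrite !inE => /or3P[] /eqP ->; apply: l1dist_ge => /=; lra.
- apply/orP; right; rewrite /= eqxx /=; apply/norP; split;
    apply/eqP => -[]; lra.
- by rewrite /lo /hi /=; lra.
- move=> q; rewrite !inE => /or3P[] /eqP ->; apply: l1dist_ge => /=; lra.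
Qed.

End Sharpness.

Theorem theorem6p13 (R : realType) (F : fieldType) :
  (forall (M N : pmodule F R) (D E : hoint R -> int)
          (Dk Ek : nat -> hoint R -> int) (K : nat),
     tame M -> tame N ->
     persistence_diagram M D -> persistence_diagram N E ->
     (forall k, (1 <= k)%N -> graded_persistence_diagram M k (Dk k)) ->
     (forall k, (1 <= k)%N -> graded_persistence_diagram N k (Ek k)) ->
     max_rank M N K ->
     [/\ forall k, (1 <= k < K)%N ->
           (W11 (Dk k) (Ek k) <= 2%:E * W11 D E)%E,
         (1 <= K)%N -> (W11 (Dk K) (Ek K) <= W11 D E)%E
       & forall k, (K < k)%N -> forall z, Dk k z = 0 /\ Ek k z = 0])
  /\
  (exists (M N : pmodule F R) (D E : hoint R -> int)
          (Dk Ek : nat -> hoint R -> int) (K : nat),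
     [/\ tame M, tame N, persistence_diagram M D & persistence_diagram N E]
     /\ (forall k, (1 <= k)%N -> graded_persistence_diagram M k (Dk k))
     /\ (forall k, (1 <= k)%N -> graded_persistence_diagram N k (Ek k))
     /\ max_rank M N K
     /\ (2 <= K)%N
     /\ (0 < W11 D E)%E
     /\ (forall k, (1 <= k < K)%N -> W11 (Dk k) (Ek k) = (2%:E * W11 D E)%E)
     /\ W11 (Dk K) (Ek K) = W11 D E).
Proof.
split.
  move=> M N D E Dk Ek K tM tN MD NE MDk NEk [_ rK].
  have MK a b h : (@rank _ _ _ M a b h <= K)%N by case: (rK a b h).
  have NK a b h : (@rank _ _ _ N a b h <= K)%N by case: (rK a b h).
  split=> [k /andP[k0 _]|K0|k Kk z].
  - exact: (graded_stability tM tN MD NE MDk NEk k0).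
  - exact: (top_graded_stability tM tN MD NE MDk NEk MK NK K0).
  - have k0 := leq_ltn_trans (leq0n K) Kk.
    by rewrite (graded_diagram0 tM Kk MK (MDk k k0))
      (graded_diagram0 tN Kk NK (NEk k k0)).
have g1 : sorted <%R [:: 0; 1; 3; 5 : R] by rewrite /=; lra.
have g2 : sorted <%R [:: 0; 2; 3; 5 : R] by rewrite /=; lra.
have le1 := W11_sharp_le1 R F.
have ge1 := W11_sharp_ge1 R F; have ge2 := W11_sharp_ge2 R F.
have S1 := graded_stability (two_bars_tame F g1) (two_bars_tame F g2)
  (two_bars_diagramP F g1) (two_bars_diagramP F g2)
  (fun k _ => two_bars_gradedP F g1 k) (fun k _ => two_bars_gradedP F g2 k)
  (k := 1) isT.
have S2 := top_graded_stability (two_bars_tame F g1) (two_bars_tame F g2)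
  (two_bars_diagramP F g1) (two_bars_diagramP F g2)
  (fun k _ => two_bars_gradedP F g1 k) (fun k _ => two_bars_gradedP F g2 k)
  (two_bars_rank_le F g1) (two_bars_rank_le F g2) isT.
have W1 : W11 (two_bars_diagram F (0 : R) 1 3 5) (two_bars_diagram F 0 2 3 5) = 1%:E.
  by apply/eqP; rewrite eq_le le1 (le_trans ge1 S2).
exists (two_bars F 0 1 3 5), (two_bars F 0 2 3 5).
exists (two_bars_diagram F 0 1 3 5), (two_bars_diagram F 0 2 3 5).
exists (two_bars_graded F 0 1 3 5), (two_bars_graded F 0 2 3 5), 2%N.
split; first by split; [exact: two_bars_tame|exact: two_bars_tame
  |exact: two_bars_diagramP|exact: two_bars_diagramP].
split; first by move=> k _; exact: two_bars_gradedP.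
split; first by move=> k _; exact: two_bars_gradedP.
split.
  split; first by exists 1, 1, (lexx _); left; exact: two_bars_rank_b.
  by move=> a b h; rewrite !two_bars_rank_le.
split=> //; split; first by rewrite W1 lte_fin ltr01.
split=> [k /andP[k1 k2]|].
  have -> : k = 1%N by apply/eqP; rewrite eqn_leq -ltnS k2.
  apply/eqP; rewrite eq_le S1 W1 mule1.
  exact: ge2.
by apply/eqP; rewrite eq_le S2 W1.
Qed.
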